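(* Let $\delta$ be a rational number and $s\geq 1$ an integer. If Algorithm $L$ performed on $(\delta;1^{\times s})$ returns ''yes'', then $$\widehat{\alpha}(s)\geq \delta,$$ where $\widehat{\alpha}(s)$ denotes the Waldschmidt constant of the ideal of $s$ very general lines in $\mathbb{P}^3$.
   Context: Ground field: $\mathbb{K}$ is uncountable, algebraically closed, of characteristic $0$; $R=\mathbb{K}[x_0,\dots,x_3]$. For a homogeneous ideal $I\subset R$, $I^{(m)}=R\cap\bigcap_{P\in\mathrm{Ass}(I)}I^mR_P$ is the $m$-th symbolic power, $\alpha(I)$ is the least degree of a nonzero element of $I$, and $\widehat{\alpha}(I)=\lim_{m\to\infty}\alpha(I^{(m)})/m$ is the Waldschmidt constant. ''Very general'' means outside a countable union of proper Zariski closed subsets of the parameter space; $\widehat{\alpha}(s)$ is the Waldschmidt constant of the radical ideal of $s$ very general lines in $\mathbb{P}^3$. The notation $m^{\times u}$ means $u$ occurrences of $m$. A rational $\tau>0$ is fixed once and for all. Algorithm $T$. Input: $(\delta;q_1,\dots,q_r;p)$ with $\delta,q_j\in\mathbb{Q}$, $r\ge1$, and an integer $p\ge0$. Put $q=\sum_{j=1}^r q_j$. Start with the formal sequence with entries in $\mathbb{Q}[t]$ $$(2\delta-q+(r-4)t;\ \delta-2t,\ \delta-q+(r-2)t,\ 1^{\times 2p}).$$ The first entry is called the degree, the other entries multiplicities. Elements of $\mathbb{Q}[t]$ are ordered by: $f>g$ if $f(\tau)>g(\tau)$. Step T1: sort the multiplicities in non-increasing order; every multiplicity $m_j$ with $m_j(\tau)\le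 0$ is replaced by $0$ (and omitted). Step T2: if there are at least three non-zero multiplicities, let $k(t)$ be the degree minus the sum of the three greatest multiplicities; if $k(\tau)<0$, add $k(t)$ to the degree and to each of the three greatest multiplicities and go to Step T1. Step T3: (if Step T2 was not performed) find four equal (non-zero) multiplicities and replace these four by a single multiplicity equal to twice their common value; go to Step T1. If neither Step T2 nor Step T3 can be performed, the algorithm terminates. Let $a+bt$ be the final degree. The output $t_0=T(\delta;q_1,\dots,q_r;p)$ is: $0$ if $a\ge 0$; $\min\{q_1,\dots,q_r\}$ if $a<0$ and $b\le 0$; $\min\{-a/b,q_1,\dots,q_r\}$ otherwise. Algorithm $L$. It works with sequences $(\delta;\overline{q_1,\dots,q_r},1^{\times p})$, where $\delta,q_1,\dots,q_r\in\mathbb{Q}$ and $r,p\geq 0$ are integers; the numbers change during the procedure. ''Performed on $(\delta;1^{\times s})$'' means started with $r=0$, $p=s$. Step 1: if ($\delta<1$ and $p\ge 1$) or ($\delta<q_j$ for some $j$), return ''yes'' and finish. Step 2: (skipped if $r=0$) run Algorithm $T$ to get $t_0=T(\delta;q_1,\dots,q_r;p)$. If $t_0\ge\tau$, replace the sequence by $(\delta-2t_0;\overline{q_1-t_0,\dots,q_r-t_0},1^{\times p})$ and go to Step 1. Step 3: if $p>0$, replace the sequence by $(\delta;\overline{q_1,\dots,q_r,1},1^{\times (p-1)})$ and go to Step 1. Step 4: answer ''no''. *)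

(* Defs.v *)
(* The notations of mpoly are not imported because they clash with those of
   MathComp-Analysis. *)
From HB Require Import structures.
From mathcomp Require Import all_boot all_order all_algebra.
From mathcomp Require Import ring_quotient.
From mathcomp Require Import all_classical all_reals all_analysis.
From mathcomp Require Export -(notations) mpoly.

Set Implicit Arguments.
Unset Strict Implicit.
Unset Printing Implicit Defensive.

Import Order.TTheory GRing.Theory Num.Theory.
Import numFieldNormedType.Exports.

Local Open Scope classical_set_scope.
Local Open Scope ring_scope.

Section Ideals.
Variable A : comNzRingType.
Implicit Types (I J P : set A).

Definition ideal_mul I J : set A :=
  [set x | exists2 s : seq (A * A),
     (forall ab, ab \in s -> I ab.1 /\ J ab.2)
     & x = \sum_(ab <- s) ab.1 * ab.2].

Definition ideal_exp I (m : nat) : set A := iter m (ideal_mul I) [set: A].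

Definition prime_ideal P : Prop :=
  idealr_closed [in P] /\ prime_idealr_closed [in P].

(* Ass(I): the prime ideals of the form (I : f). *)
Definition Ass I : set (set A) :=
  [set P | prime_ideal P /\ exists f, P = [set g | I (g * f)]].

(* A \cap \bigcap_{P in Ass(I)} I^m A_P; when A is a domain, f lies in I^m A_P
   iff f = h / g with h in I^m and g outside P. *)
Definition symbolic_power I (m : nat) : set A :=
  [set f | forall P, Ass I P -> exists2 g, ~ P g & ideal_exp I m (g * f)].

End Ideals.

Section Waldschmidt.
Variables (K : fieldType) (R : realType).

(* The degree of a nonzero f is (msize f).-1. *)
Definition alpha n (I : set (mpoly n K)) : nat :=
  get [set d | (exists2 f, I f & msize f = d.+1)
               /\ forall f, I f -> f != 0 -> (d.+1 <= msize f)%N].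

Definition waldschmidt n (I : set (mpoly n K)) : R :=
  lim ((fun m : nat => (alpha (symbolic_power I m))%:R / m%:R : R) @ \oo).

End Waldschmidt.

Section Lines.
Variable K : fieldType.

(* Lines of P^3, i.e., the points of the Grassmannian G(2, 4). *)
Definition line : Type := {L : {vspace 'rV[K]_4} | \dim L == 2%N}.

Definition plucker (u v : 'rV[K]_4) (a b : 'I_4) : K :=
  u 0 a * v 0 b - u 0 b * v 0 a.

Section Configurations.
Variable s : nat.

(* The radical ideal of the union of the lines L 0, ..., L (s-1).  Since each
   line is a linear subspace of K^4, all polynomials (not just forms) vanishing
   on it form, over an infinite field, the homogeneous ideal of the line. *)
Definition lines_ideal (L : 'I_s -> line) : set (mpoly 4 K) :=
  [set f | forall i (x : 'rV[K]_4), x \in val (L i) -> meval (x 0) f = 0].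

Definition plucker_index : finType := ('I_s * 'I_4 * 'I_4)%type.

Definition plucker_point (u v : 'I_s -> 'rV[K]_4) (k : 'I_#|plucker_index|) :
  K := let: (i, a, b) := enum_val k in plucker (u i) (v i) a b.

(* Zariski closed subsets of G(2, 4)^s, embedded by the Plucker coordinates of
   the s factors.  As Z is a set of tuples of lines, the condition for all
   choices of bases forces the zero locus of S to be invariant under rescaling
   of the coordinates of each factor, so that S needs not be assumed to consist
   of multihomogeneous polynomials. *)
Definition zariski_closed (Z : set ('I_s -> line)) : Prop :=
  exists S : set (mpoly #|plucker_index| K),
    forall (L : 'I_s -> line) (u v : 'I_s -> 'rV[K]_4),
      (forall i, basis_of (val (L i)) [:: u i; v i]) ->
      (Z L <-> forall F, S F -> meval (plucker_point u v) F = 0).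

Definition very_general (Q : ('I_s -> line) -> Prop) : Prop :=
  exists Z : nat -> set ('I_s -> line),
    (forall n, zariski_closed (Z n) /\ Z n <> setT)
    /\ forall L, ~ (\bigcup_n Z n) L -> Q L.

End Configurations.

(* The common value of the Waldschmidt constants of the ideals of s very
   general lines; over an uncountable algebraically closed field it exists and
   is unique. *)
Definition alpha_hat (R : realType) (s : nat) : R :=
  get [set c : R | very_general (fun L : 'I_s -> line =>
                     waldschmidt R (lines_ideal L) = c)].

End Lines.

(* The algorithms leave open how ties are broken in sorting and which four
   equal multiplicities are taken; they are rendered as relations between inputs
   and outputs that hold of every legitimate execution. *)
Section AlgorithmT.
Variable tau : rat.
Implicit Types (d k m : {poly rat}) (ms : seq {poly rat}).

Definition stepT1 ms ms' : Prop :=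
  perm_eq ms' [seq m <- ms | 0 < m.[tau]]
  /\ sorted (fun f g => g.[tau] <= f.[tau]) ms'.

Definition applicableT2 d ms : bool :=
  if ms is [:: m1, m2, m3 & _] then (d - (m1 + m2 + m3)).[tau] < 0 else false.

(* "Equal" means equal in Q[t], not merely at tau. *)
Definition applicableT3 ms : bool := has (fun m => (4 <= count_mem m ms)%N) ms.

(* runT d ms d': from degree d and multiplicities ms, about to perform Step T1,
   the algorithm terminates with final degree d'. *)
Inductive runT : {poly rat} -> seq {poly rat} -> {poly rat} -> Prop :=
| runT2 d ms m1 m2 m3 ms' k d' :
    stepT1 ms [:: m1, m2, m3 & ms'] ->
    applicableT2 d [:: m1, m2, m3 & ms'] ->
    k = d - (m1 + m2 + m3) ->
    runT (d + k) [:: m1 + k, m2 + k, m3 + k & ms'] d' ->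
    runT d ms d'
| runT3 d ms ms1 m ms' d' :
    stepT1 ms ms1 ->
    ~~ applicableT2 d ms1 ->
    perm_eq ms1 [:: m, m, m, m & ms'] ->
    runT d (m *+ 2 :: ms') d' ->
    runT d ms d'
| runT_end d ms ms1 :
    stepT1 ms ms1 ->
    ~~ applicableT2 d ms1 ->
    ~~ applicableT3 ms1 ->
    runT d ms d.

Definition initial_degreeT (delta : rat) (qs : seq rat) : {poly rat} :=
  (2%:R * delta - \sum_(q <- qs) q)%:P + ((size qs)%:R - 4%:R) *: 'X.

Definition initial_multsT (delta : rat) (qs : seq rat) (p : nat) :
    seq {poly rat} :=
  [:: delta%:P - 2%:R *: 'X,
      (delta - \sum_(q <- qs) q)%:P + ((size qs)%:R - 2%:R) *: 'X
    & nseq (2 * p) 1].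

Definition outputT (qs : seq rat) (d : {poly rat}) : rat :=
  let a := d`_0 in
  let b := d`_1 in
  if 0 <= a then 0
  else if b <= 0 then \big[Num.min/head 0 qs]_(q <- qs) q
  else \big[Num.min/(- a / b)]_(q <- qs) q.

(* T(delta; qs; p) may output t0. *)
Definition algT (delta : rat) (qs : seq rat) (p : nat) (t0 : rat) : Prop :=
  exists2 d, runT (initial_degreeT delta qs) (initial_multsT delta qs p) d
           & t0 = outputT qs d.

End AlgorithmT.

Section AlgorithmL.
Variable tau : rat.

Definition stopL (delta : rat) (qs : seq rat) (p : nat) : bool :=
  ((delta < 1) && (1 <= p)%N) || has (fun q => delta < q) qs.

(* Step 2 is skipped or fails to replace the sequence. *)
Definition passL2 (delta : rat) (qs : seq rat) (p : nat) : Prop :=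
  qs = [::] \/ exists2 t0, algT tau delta qs p t0 & t0 < tau.

(* algL delta qs p ans: from (delta; \overline{qs}, 1^{x p}), about to perform
   Step 1, the algorithm answers "yes" (ans = true) or "no" (ans = false). *)
Inductive algL : rat -> seq rat -> nat -> bool -> Prop :=
| algL1 delta qs p :
    stopL delta qs p -> algL delta qs p true
| algL2 delta qs p t0 ans :
    ~~ stopL delta qs p ->
    qs <> [::] ->
    algT tau delta qs p t0 ->
    tau <= t0 ->
    algL (delta - 2%:R * t0) [seq q - t0 | q <- qs] p ans ->
    algL delta qs p ans
| algL3 delta qs p ans :
    ~~ stopL delta qs p.+1 ->
    passL2 delta qs p.+1 ->
    algL delta (rcons qs 1) p ans ->
    algL delta qs p.+1 ans
| algL4 delta qs :
    ~~ stopL delta qs 0 ->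
    passL2 delta qs 0 ->
    algL delta qs 0 false.

End AlgorithmL.

(* Main.v *)
Require Import Defs.
From HB Require Import structures.
From mathcomp Require Import all_boot all_order all_algebra.
From mathcomp Require Import ring_quotient zify ring lra.
From mathcomp Require Import all_classical all_reals all_analysis.

(* By semicontinuity, if no form of degree D vanishes to orders >= m_i along one
   configuration of linear subspaces, then none does along a general one; so the
   steps of the algorithms can be proved sound by specializing the lines.
   - A form whose restriction to a smooth quadric Q vanishes is divisible by the
     equation of Q.  If lines of one ruling have multiplicities M_j, the restriction
     is a curve of bidegree (D, D - sum M_j), i.e., a plane curve of degree
     2D - sum M_j with two further points of multiplicities D and D - sum M_j.
   - T2 is the quadratic Cremona transformation; as it acts on exponents by an
     affine map, it is valid for all integers D, m_i, of whatever sign.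
   - T3 lets four m-fold points tend to one point, which is then 2m-fold because
     no plane curve of degree < 2m has four general m-fold points.
   Each of these steps is valid for every value of t, and not only for t = tau:
   the order at tau just selects the operations.  Scaled by a common denominator
   N, a run of Algorithm L that answers "yes" thus shows that no form of degree
   N delta vanishes to order N along s general lines, for infinitely many N.
   The symbolic power I^(m) of the ideal of lines consists of the polynomials
   vanishing to order >= m on each line, so that alpha(I^(m)) attains its maximum
   on the complement of a closed set, and Fekete's lemma turns the inequalities
   alpha(I^(N)) > N delta into a bound on the limit. *)

Set Implicit Arguments.
Unset Strict Implicit.
Unset Printing Implicit Defensive.

Import Order.TTheory GRing.Theory Num.Theory.
Import numFieldNormedType.Exports.

Local Open Scope classical_set_scope.
Local Open Scope ring_scope.

Local Notation "F @_ m" := (mcoeff m F) (at level 3, m at level 2, format "F @_ m").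

(** * Orders of vanishing *)

(** Runs are read backwards: emptiness of the system after a step implies emptiness before it, and a
    run ends with a negative degree or a multiplicity above the degree. A Step 2 of Algorithm L with
    value t0 stands for N t0 quadrics split off one by one. After i of them the system restricted to
    the quadric is the initial sequence of Algorithm T at t = i/N, so one run of T, with its
    branches chosen at tau, has to be followed at all these t. There a dropped multiplicity may be
    positive and a kept one negative, whence integer orders throughout. The order along a line is
    imposed at its points along all arcs. These are infinitely many linear conditions on a
    finite-dimensional space, so finitely many of them suffice, and a determinant that is nonzero at
    one configuration spreads emptiness to an open set. *)

Section Valuation.
Variable K : fieldType.
Implicit Types (p q : {poly K}) (M : int).

Definition vge p M := forall j : nat, j%:Z < M -> p`_j = 0.

Lemma vge_le p M M' : M' <= M -> vge p M -> vge p M'.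
Proof. by move=> le pM j jM; apply: pM; apply: lt_le_trans jM le. Qed.

Lemma vge0 M : vge 0 M. Proof. by move=> j _; rewrite coef0. Qed.

Lemma vge_npos p M : M <= 0 -> vge p M.
Proof. by move=> M0 j; lia. Qed.

Lemma vgeD p q M : vge p M -> vge q M -> vge (p + q) M.
Proof. by move=> pM qM j jM; rewrite coefD pM // qM // addr0. Qed.

Lemma vge_sum (I : eqType) (r : seq I) (F : I -> {poly K}) M :
  (forall i, i \in r -> vge (F i) M) -> vge (\sum_(i <- r) F i) M.
Proof.
elim: r => [|i r IH] H; first by rewrite big_nil; apply: vge0.
rewrite big_cons; apply: vgeD; first by apply: H; rewrite mem_head.
by apply: IH => k kr; apply: H; rewrite in_cons kr orbT.
Qed.

Lemma vgeM p q M N : vge p M -> vge q N -> vge (p * q) (M + N).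
Proof.
move=> pM qN j jMN; rewrite coefM big1 // => i _.
have [iM|iM] := ltP (i%:Z) M; first by rewrite pM // mul0r.
by rewrite qN ?mulr0 //; have := ltn_ord i; lia.
Qed.

Lemma vge_prod (I : Type) (r : seq I) (F : I -> {poly K}) (M : I -> int) :
  (forall i, vge (F i) (M i)) -> vge (\prod_(i <- r) F i) (\sum_(i <- r) M i).
Proof.
move=> H; elim: r => [|i r IH]; first by rewrite !big_nil; apply: vge_npos.
by rewrite !big_cons; apply: vgeM.
Qed.

Lemma vgeX p (M : int) k : vge p M -> vge (p ^+ k) (k%:Z * M).
Proof.
move=> pM; elim: k => [|k IH]; first by rewrite mul0r; apply: vge_npos.
by rewrite exprS (_ : _ * M = M + k%:Z * M); [apply: vgeM|lia].
Qed.

Lemma vge_mulX p : vge ('X * p) 1.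
Proof. by move=> j; rewrite coefXM; case: j. Qed.

(** The order e' of [p] is at most [e]. By strong induction on j, the coefficient of index e' + j in
    [p * q] reduces to the single term p_e' q_j. *)
Lemma vge_div p q M e : vge (p * q) M -> p`_e != 0 -> vge q (M - e%:Z).
Proof.
move=> pqM pe.
have [e' pe' e'min] := ex_minnP (ex_intro (fun e => p`_e != 0) e pe).
have e'e := e'min _ pe.
elim/ltn_ind => j IH jM.
have: (p * q)`_(e' + j) = 0 by apply: pqM; lia.
have lt : (e' < (e' + j).+1)%N by lia.
rewrite coefM (bigD1 (Ordinal lt)) //= big1 ?addr0.
  by move/eqP; rewrite mulf_eq0 (negPf pe') /= addKn => /eqP.
move=> i /eqP ine; have [ilt|ige] := ltnP i e'.
  have [->|/e'min] := eqVneq p`_i 0; first by rewrite mul0r.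
  by lia.
have {}ine : (i : nat) <> e' by move=> E; apply: ine; apply: val_inj.
by rewrite IH ?mulr0 //; have := ltn_ord i; lia.
Qed.

End Valuation.

Section Subst.
Variable K : fieldType.

Definition psub n (F : mpoly n K) (z : 'rV[{poly K}]_n) : {poly K} :=
  mmap (@polyC K) (z 0) F.

Definition msub n n' (k : 'I_n -> mpoly n' K) (F : mpoly n K) : mpoly n' K :=
  mmap (@mpolyC n' K) k F.

Section OneN.
Variable n : nat.
Implicit Types (F G : mpoly n K) (z : 'rV[{poly K}]_n).

Lemma psub0 z : psub 0 z = 0. Proof. exact: mmap0. Qed.
Lemma psubD F G z : psub (F + G) z = psub F z + psub G z. Proof. exact: mmapD. Qed.
Lemma psubB F G z : psub (F - G) z = psub F z - psub G z. Proof. exact: mmapB. Qed.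
Lemma psubM F G z : psub (F * G) z = psub F z * psub G z. Proof. exact: rmorphM. Qed.
Lemma psubZ c F z : psub (c *: F) z = c%:P * psub F z. Proof. exact: mmapZ. Qed.
Lemma psubX m z : psub (mpolyX K m) z = \prod_i (z 0 i) ^+ (m i).
Proof. by rewrite /psub mmapX. Qed.
Lemma psubXU i z : psub (mpolyX K (mnm1 i)) z = z 0 i.
Proof. by rewrite /psub mmapX mmap1U. Qed.
Lemma psubE F z :
  psub F z = \sum_(m <- msupp F) (F@_m)%:P * \prod_i (z 0 i) ^+ (m i).
Proof. by []. Qed.

Lemma horner_psub F z t : (psub F z).[t] = meval (fun i => (z 0 i).[t]) F.
Proof.
rewrite psubE mevalE horner_sum; apply: eq_bigr => m _.
rewrite hornerM hornerC; congr (_ * _).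
by rewrite horner_prod; apply: eq_bigr => i _; rewrite horner_exp.
Qed.

End OneN.

Section TwoN.
Variables (n n' : nat) (k : 'I_n -> mpoly n' K).
Implicit Types (F G : mpoly n K).
Lemma msubD F G : msub k (F + G) = msub k F + msub k G. Proof. exact: mmapD. Qed.
Lemma msubB F G : msub k (F - G) = msub k F - msub k G. Proof. exact: mmapB. Qed.
Lemma msubM F G : msub k (F * G) = msub k F * msub k G. Proof. exact: rmorphM. Qed.
Lemma msubZ c F : msub k (c *: F) = c *: msub k F.
Proof. by rewrite /msub mmapZ mul_mpolyC. Qed.
Lemma msubX m : msub k (mpolyX K m) = \prod_i (k i) ^+ (m i).
Proof. by rewrite /msub mmapX. Qed.
Lemma msubE F : msub k F = \sum_(m <- msupp F) F@_m *: \prod_i (k i) ^+ (m i).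
Proof. by rewrite /msub /mmap; apply: eq_bigr => m _; rewrite mul_mpolyC. Qed.

Lemma psub_msub F z : psub (msub k F) z = psub F (\row_i psub (k i) z).
Proof.
rewrite msubE [RHS]psubE /psub raddf_sum; apply: eq_bigr => m _ /=.
rewrite mmapZ rmorph_prod; congr (_ * _).
by apply: eq_bigr => i _; rewrite rmorphXn mxE.
Qed.

Lemma meval_msub F x : meval x (msub k F) = meval (fun i => meval x (k i)) F.
Proof.
rewrite msubE [RHS]mevalE raddf_sum; apply: eq_bigr => m _ /=.
by rewrite mevalZ rmorph_prod; congr (_ * _); apply: eq_bigr => i _; rewrite rmorphXn.
Qed.
End TwoN.
End Subst.

Section Ord.
Variables (K : fieldType) (n : nat).
Implicit Types (F G : mpoly n K) (x : 'rV[K]_n) (y : 'rV[{poly K}]_n) (M : int).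

Definition jet x y : 'rV[{poly K}]_n := \row_i ((x 0 i)%:P + 'X * y 0 i).

(* F vanishes to order >= M at x: F(x + T y(T)) = O(T^M) along every arc. *)
Definition ordge F x M := forall y, vge (psub F (jet x y)) M.

Lemma ordge_le F x M M' : M' <= M -> ordge F x M -> ordge F x M'.
Proof. by move=> le H y; apply: vge_le le (H y). Qed.
Lemma ordge_npos F x M : M <= 0 -> ordge F x M.
Proof. by move=> M0 y; apply: vge_npos. Qed.
Lemma ordge0 x M : ordge 0 x M. Proof. by move=> y; rewrite psub0; apply: vge0. Qed.
Lemma ordgeM F G x M N : ordge F x M -> ordge G x N -> ordge (F * G) x (M + N).
Proof. by move=> HF HG y; rewrite psubM; apply: vgeM. Qed.
Lemma ordge_sum (I : eqType) (r : seq I) (F : I -> mpoly n K) x M :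
  (forall i, i \in r -> ordge (F i) x M) -> ordge (\sum_(i <- r) F i) x M.
Proof.
move=> H y; rewrite /psub raddf_sum; apply: vge_sum => i ir; exact: H.
Qed.

Lemma psub_jet_coef0 F x y : (psub F (jet x y))`_0 = meval (x 0) F.
Proof.
rewrite -horner_coef0 horner_psub; apply: meval_eq => i.
by rewrite !mxE !hornerE.
Qed.

Lemma ordge1P F x : meval (x 0) F = 0 <-> ordge F x 1.
Proof.
split=> [H y j|H]; last by rewrite -(psub_jet_coef0 F x 0) H.
by case: j => // _; rewrite psub_jet_coef0.
Qed.

Lemma ordgeZ c F x M : ordge F x M -> ordge (c *: F) x M.
Proof.
by move=> H; rewrite -mul_mpolyC -[M]add0r; apply: ordgeM => //; apply: ordge_npos.
Qed.

End Ord.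

Lemma ordge_msub (K : fieldType) n n' (k : 'I_n -> mpoly n' K) (F : mpoly n K)
    (x : 'rV[K]_n') (M : int) :
  ordge F (\row_i meval (x 0) (k i)) M -> ordge (msub k F) x M.
Proof.
move=> H y; rewrite psub_msub.
(* The image arc without its constant term, divided by the parameter: arcs at [x] go to arcs at the
   image point. *)
pose w := \row_i (\poly_(j < size (psub (k i) (jet x y))) (psub (k i) (jet x y))`_j.+1).
suff -> : \row_i psub (k i) (jet x y) = jet (\row_i meval (x 0) (k i)) w by apply: H.
apply/rowP => i; rewrite !mxE -(psub_jet_coef0 _ _ y).
set p := psub _ _; apply/polyP => -[|j].
  by rewrite coefD coefC coefXM addr0.
rewrite coefD coefC coefXM /= add0r coef_poly; case: ltnP => // szp.
by rewrite nth_default // (leq_trans szp).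
Qed.

(** * Functions depending polynomially on parameters *)

Section Avoid.
Variables (K : fieldType) (I : Type).
(** Two instances occur: a one-point [I], over any algebraically closed field, and [I = nat], where
    [K] has to be uncountable. *)
Hypothesis avoid1 : forall p : I -> {poly K}, (forall i, p i != 0) ->
  exists t, forall i, (p i).[t] != 0.

(* The coordinates are chosen one at a time, the last one first. *)
Lemma mpoly_avoid n (F : I -> mpoly n K) : (forall i, F i != 0) ->
  exists x : 'rV[K]_n, forall i, meval (x 0) (F i) != 0.
Proof.
elim: n F => [|n IH] F F0.
  exists 0 => i; have := F0 i; rewrite (nvar0_mpolyC (F i)) mevalC.
  by rewrite mpolyC_eq0.
pose res (m : multinom n.+1) : multinom n := Multinom [tuple m (widen_ord (leqnSn n) i) | i < n].
have resE m i : res m i = m (widen_ord (leqnSn n) i).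
  by rewrite multinomE tnth_mktuple.
pose k (t : K) (i : 'I_n.+1) : mpoly n K :=
  if unlift ord_max i is Some j then mpolyX K (mnm1 j) else mpolyC n t.
have kX t (m : multinom n.+1) :
    \prod_i (k t i) ^+ (m i) = t ^+ (m ord_max) *: mpolyX K (res m).
  rewrite big_ord_recr /= [X in _ * X](_ : _ = mpolyC n (t ^+ m ord_max)).
    rewrite mulrC mul_mpolyC mpolyXE_id; congr (_ *: _).
    apply: eq_bigr => i _; rewrite resE /k.
    have -> : widen_ord (leqnSn n) i = lift ord_max i.
      by apply: ord_inj; rewrite lift_max.
    by rewrite liftK.
  by rewrite /k unlift_none rmorphXn.
(* The coefficient of the monomial b in the first n variables, as a polynomial in the last one;
   [k t] sets that variable to t. *)
pose p (G : mpoly n.+1 K) (b : multinom n) :=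
  \sum_(m <- msupp G | res m == b) G@_m *: 'X^(m ord_max).
have pE G b t : (msub (k t) G)@_b = (p G b).[t].
  rewrite msubE raddf_sum /= horner_sum big_mkcond [RHS]big_mkcond /=.
  apply: eq_bigr => m _; rewrite kX !mcoeffZ mcoeffX.
  by case: eqP => _; rewrite ?mulr1 ?mulr0 // hornerZ hornerXn.
have res_inj m m' : res m = res m' -> m ord_max = m' ord_max -> m = m'.
  move=> E1 E2; apply/mnmP => i.
  case: (unliftP ord_max i) => [j ->|-> //].
  have -> : lift ord_max j = widen_ord (leqnSn n) j.
    by apply: ord_inj; rewrite lift_max.
  by rewrite -!resE E1.
have p0 G : G != 0 -> exists b, p G b != 0.
  rewrite -msupp_eq0; case E: (msupp G) => [//|m0 s] _.
  have m0G : m0 \in msupp G by rewrite E mem_head.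
  exists (res m0); apply: contraTneq (m0G) => pb0.
  rewrite mcoeff_msupp negbK; apply/eqP.
  have := congr1 (fun q : {poly K} => q`_(m0 ord_max)) pb0.
  rewrite coef0 /p coef_sum big_mkcond (bigD1_seq m0) ?msupp_uniq //= eqxx.
  rewrite coefZ coefXn eqxx mulr1 big1 ?addr0 // => m mm0.
  case: eqP => // rm; rewrite coefZ coefXn; case: eqP; rewrite ?mulr0 // => E'.
  by rewrite (res_inj m m0) ?eqxx in mm0.
have [b pb] := choice (fun i => p0 _ (F0 i)).
have [t tP] := avoid1 pb.
have [i|x xP] := IH (fun i => msub (k t) (F i)).
  apply: contraNneq (tP i) => /(congr1 (mcoeff (b i))).
  by rewrite pE mcoeff0 => /eqP.
exists (\row_i if unlift ord_max i is Some j then x 0 j else t) => i.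
have := xP i; rewrite meval_msub; congr (_ != _); apply: meval_eq => j.
by rewrite mxE /k; case: unlift => [l|]; rewrite ?mevalXU ?mevalC.
Qed.
End Avoid.

Section Closed.
Variable K : closedFieldType.

Lemma poly_nonroot (p : {poly K}) : p != 0 -> exists t, p.[t] != 0.
Proof. by move/closed_nonrootP => [t]; exists t. Qed.

Lemma mpoly_nonroot n (F : mpoly n K) :
  F != 0 -> exists x : 'rV[K]_n, meval (x 0) F != 0.
Proof.
move=> F0; have av p : (forall i : unit, p i != 0) -> exists t : K, forall i, (p i).[t] != 0.
  by move=> /(_ tt) /poly_nonroot[t tp]; exists t; case.
by have [x xP] := mpoly_avoid av (fun=> F0); exists x; apply: (xP tt).
Qed.

Lemma mpoly_eq0_off n (F q : mpoly n K) : q != 0 ->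
  (forall x : 'rV[K]_n, meval (x 0) q != 0 -> meval (x 0) F = 0) -> F = 0.
Proof.
move=> q0 H; apply/eqP; apply: contraT => F0.
have /mpoly_nonroot[x] : q * F != 0 by rewrite mulf_neq0.
by rewrite mevalM mulf_eq0 negb_or => /andP[/H ->]; rewrite eqxx.
Qed.

Lemma mpoly_eq0 n (F : mpoly n K) : (forall x : 'rV[K]_n, meval (x 0) F = 0) -> F = 0.
Proof. by move=> H; apply: (@mpoly_eq0_off _ F 1) => //; apply: oner_neq0. Qed.

Section Reg.
Variables (W : Type) (reg : (W -> K) -> Prop).

(* reg is a K-algebra of functions on W, to be thought of as the regular ones. *)
Record regalg : Prop := Regalg {
  reg_cst : forall c, reg (fun=> c);
  reg_add : forall f g, reg f -> reg g -> reg (fun a => f a + g a);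
  reg_mul : forall f g, reg f -> reg g -> reg (fun a => f a * g a) }.

Hypothesis H : regalg.

Lemma reg_ext f g : f =1 g -> reg f -> reg g.
Proof. by move=> /funext ->. Qed.

Lemma reg_sum (I : Type) (r : seq I) (F : I -> W -> K) :
  (forall i, reg (F i)) -> reg (fun a => \sum_(i <- r) F i a).
Proof.
move=> rF; elim: r => [|i r IH].
  by apply: (reg_ext _ (reg_cst H 0)) => a; rewrite big_nil.
apply: (@reg_ext (fun a => F i a + \sum_(i <- r) F i a)) => [a|].
  by rewrite big_cons.
exact: (reg_add H).
Qed.

Lemma reg_prod (I : eqType) (r : seq I) (F : I -> W -> K) :
  (forall i, i \in r -> reg (F i)) -> reg (fun a => \prod_(i <- r) F i a).
Proof.
elim: r => [|i r IH] rF.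
  by apply: (reg_ext _ (reg_cst H 1)) => a; rewrite big_nil.
apply: (@reg_ext (fun a => F i a * \prod_(i <- r) F i a)) => [a|].
  by rewrite big_cons.
apply: (reg_mul H) => //; first by apply: rF; rewrite mem_head.
by apply: IH => j jr; apply: rF; rewrite in_cons jr orbT.
Qed.

Lemma reg_opp f : reg f -> reg (fun a => - f a).
Proof.
move=> rf; apply: (@reg_ext (fun a => -1 * f a)) => [a|]; first by rewrite mulN1r.
exact: (reg_mul H) (reg_cst H _) rf.
Qed.

Lemma reg_sub f g : reg f -> reg g -> reg (fun a => f a - g a).
Proof. by move=> rf rg; apply: (reg_add H) rf (reg_opp rg). Qed.

Lemma reg_exp f k : reg f -> reg (fun a => f a ^+ k).
Proof.
move=> rf; elim: k => [|k IH]; first exact: (reg_cst H).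
by apply: (@reg_ext (fun a => f a * f a ^+ k)) => [a|]; [rewrite exprS|apply: (reg_mul H)].
Qed.

Lemma reg_det k (A : W -> 'M[K]_k) :
  (forall i j, reg (fun a => A a i j)) -> reg (fun a => \det (A a)).
Proof.
move=> rA; apply: reg_sum => s; apply: (reg_mul H); first exact: (reg_cst H).
by apply: reg_prod => i _.
Qed.

Definition regp (P : W -> {poly K}) := forall j, reg (fun a => (P a)`_j).

Lemma regp_cst p : regp (fun=> p). Proof. by move=> j; apply: (reg_cst H). Qed.

Lemma regp_C f : reg f -> regp (fun a => (f a)%:P).
Proof.
move=> rf [|j]; first by apply: (reg_ext _ rf) => a; rewrite coefC.
by apply: (reg_ext _ (reg_cst H 0)) => a; rewrite coefC.
Qed.

Lemma regp_add P Q : regp P -> regp Q -> regp (fun a => P a + Q a).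
Proof.
move=> rP rQ j; apply: (reg_ext _ (reg_add H (rP j) (rQ j))) => a.
by rewrite coefD.
Qed.

Lemma regp_mul P Q : regp P -> regp Q -> regp (fun a => P a * Q a).
Proof.
move=> rP rQ j.
apply: (@reg_ext (fun a => \sum_(i < j.+1) (P a)`_i * (Q a)`_(j - i))) => [a|].
  by rewrite coefM.
by apply: reg_sum => i; apply: (reg_mul H).
Qed.

Lemma regp_prod (I : eqType) (r : seq I) (F : I -> W -> {poly K}) :
  (forall i, i \in r -> regp (F i)) -> regp (fun a => \prod_(i <- r) F i a).
Proof.
elim: r => [|i r IH] rF j.
  by apply: (reg_ext _ (regp_cst 1 j)) => a; rewrite big_nil.
apply: (@reg_ext (fun a => (F i a * \prod_(i <- r) F i a)`_j)) => [a|].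
  by rewrite big_cons.
apply: regp_mul => [|l]; first by apply: rF; rewrite mem_head.
by apply: IH => j' jr; apply: rF; rewrite in_cons jr orbT.
Qed.

Lemma regp_exp P k : regp P -> regp (fun a => P a ^+ k).
Proof.
move=> rP; elim: k => [|k IH] j.
  by apply: (reg_ext _ (reg_cst H (1 : {poly K})`_j)) => a; rewrite expr0.
apply: (@reg_ext (fun a => (P a * P a ^+ k)`_j)) => [a|]; first by rewrite exprS.
exact: regp_mul.
Qed.

Lemma regp_psub n (F : mpoly n K) (z : W -> 'rV[{poly K}]_n) :
  (forall i, regp (fun a => z a 0 i)) -> regp (fun a => psub F (z a)).
Proof.
move=> rz j.
apply: (@reg_ext (fun a => \sum_(m <- msupp F)
   ((F@_m)%:P * \prod_i (z a 0 i) ^+ (m i))`_j)) => [a|].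
  by rewrite psubE coef_sum.
apply: reg_sum => m; apply: regp_mul; first exact: regp_cst.
by apply: regp_prod => i _; apply: regp_exp.
Qed.

Lemma regp_jet n (F : mpoly n K) (x : W -> 'rV[K]_n) (y : 'rV[{poly K}]_n) :
  (forall i, reg (fun a => x a 0 i)) -> regp (fun a => psub F (jet (x a) y)).
Proof.
move=> rx; apply: regp_psub => i j.
apply: (@reg_ext (fun a => ((x a 0 i)%:P + 'X * y 0 i : {poly K})`_j)) => [a|].
  by rewrite mxE.
by apply: regp_add; [apply: regp_C|apply: regp_cst].
Qed.

End Reg.

Definition reg1 (f : K -> K) := exists p : {poly K}, forall s, f s = p.[s].

Lemma reg1_alg : regalg reg1.
Proof.
split=> [c|f g [p fp] [q gq]|f g [p fp] [q gq]].
- by exists c%:P => s; rewrite hornerC.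
- by exists (p + q) => s; rewrite hornerD fp gq.
- by exists (p * q) => s; rewrite hornerM fp gq.
Qed.

Lemma reg1_id : reg1 id. Proof. by exists 'X => s; rewrite hornerX. Qed.

Lemma reg1_line a b : reg1 (fun s => a + s * b).
Proof. by exists (a%:P + 'X * b%:P) => s; rewrite !hornerE. Qed.

Lemma reg1_nonroot f g s s' : reg1 f -> reg1 g -> f s != 0 -> g s' != 0 ->
  exists t, f t != 0 /\ g t != 0.
Proof.
move=> [p fp] [q gq]; rewrite fp gq => ps qs.
have p0 : p != 0 by apply: contraNneq ps => ->; rewrite horner0.
have q0 : q != 0 by apply: contraNneq qs => ->; rewrite horner0.
have /poly_nonroot[t] : p * q != 0 by rewrite mulf_neq0.
by rewrite hornerM mulf_eq0 negb_or -fp -gq => /andP[? ?]; exists t.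
Qed.

(** Density of nonempty open subsets of the affine line; it removes exceptional points and arcs from
    the conditions below. *)
Lemma reg1_null f g s' : reg1 f -> reg1 g -> g s' != 0 ->
  (forall s, g s != 0 -> f s = 0) -> forall s, f s = 0.
Proof.
move=> rf rg gs' H s; apply/eqP; apply: contraT => fs.
by have [t [ft /H]] := reg1_nonroot rf rg fs gs'; move/eqP; rewrite (negPf ft).
Qed.

Section OrdLines.
Variable n : nat.
Implicit Types (F G : mpoly n K) (x : 'rV[K]_n).

Lemma ordge_line F x v M g s' : reg1 g -> g s' != 0 ->
  (forall s, g s != 0 -> ordge F (x + s *: v) M) ->
  forall s, ordge F (x + s *: v) M.
Proof.
move=> rg gs' H s y j jM; move: s.
apply: (@reg1_null (fun s => (psub F (jet (x + s *: v) y))`_j) g s') => //.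
  apply: (regp_jet reg1_alg) => i.
  by apply: reg_ext (reg1_line (x 0 i) (v 0 i)) => s; rewrite !mxE.
by move=> s /H /(_ y); apply.
Qed.

(** One arc [y0] on which [q] has order at most [e] is enough. On the pencil joining any [y] to
    [y0], the coefficient of index [e] of [q] is nonzero for almost all parameters. There [vge_div]
    bounds the order of [F], and the bound extends to [y] by density. *)
Lemma ordge_div q F x M e y0 : ordge (q * F) x M ->
  (psub q (jet x y0))`_e != 0 -> ordge F x (M - e%:Z).
Proof.
move=> qFM qe y j jM.
pose ys s := y + s%:P *: (y0 - y).
have rys G l : reg1 (fun s => (psub G (jet x (ys s)))`_l).
  apply: (regp_psub reg1_alg) => i.
  have R : forall j, reg1 (fun s => ((x 0 i)%:P + 'X * (y 0 i + s%:P * (y0 0 i - y 0 i)) : {poly K})`_j).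
    apply: (regp_add reg1_alg); first exact: (regp_cst reg1_alg).
    apply: (regp_mul reg1_alg); first exact: (regp_cst reg1_alg).
    apply: (regp_add reg1_alg); first exact: (regp_cst reg1_alg).
    apply: (regp_mul reg1_alg); last exact: (regp_cst reg1_alg).
    exact: (regp_C reg1_alg) reg1_id.
  by move=> l'; apply: reg_ext (R l') => s; rewrite !mxE.
have -> : y = ys 0 by rewrite /ys scale0r addr0.
apply: (@reg1_null (fun s => (psub F (jet x (ys s)))`_j)
  (fun s => (psub q (jet x (ys s)))`_e) 1) => //.
  by rewrite /ys scale1r addrC subrK.
move=> s qs; have := qFM (ys s); rewrite psubM => /vge_div /(_ qs).
by apply.
Qed.

Lemma ordge_div0 q F x M : ordge (q * F) x M -> meval (x 0) q != 0 -> ordge F x M.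
Proof.
move=> qF q0; rewrite -[M]subr0; apply: (ordge_div (y0 := 0) qF).
by rewrite psub_jet_coef0.
Qed.

End OrdLines.
End Closed.

(** * Semicontinuity *)

Section Dual.
Variables (K : fieldType) (I : Type).

(** A functional that is nonzero on [U] has a kernel of smaller dimension, so the choice of
    functionals stops after finitely many. *)
Lemma finite_annihilator k (u : I -> 'cV[K]_k) (U : {vspace 'rV[K]_k}) :
  (forall c, c \in U -> (forall i, c *m u i = 0) -> c = 0) ->
  exists s : seq I,
    forall c, c \in U -> all (fun i => c *m u i == 0) s -> c = 0.
Proof.
have [d] := ubnP (\dim U); elim: d U => // d IH U dU U0.
have [->|Un0] := eqVneq U 0%VS; first by exists [::] => c; rewrite memv0 => /eqP.
have [i ui] : exists i, vpick U *m u i != 0.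
  apply: contrapT => /forallNP H; move: Un0; rewrite -vpick0 (U0 _ (memv_pick U)) ?eqxx //.
  by move=> i; apply/eqP; apply: contrapT => /negP; apply: H.
pose f := linfun (mulmxr (u i) : 'rV[K]_k -> 'rV[K]_1).
have fE c : f c = c *m u i by rewrite lfunE.
have [||s sP] := IH (U :&: lker f)%VS.
- apply: leq_trans (_ : \dim U <= d)%N; last by rewrite -ltnS.
  rewrite ltnNge; apply/negP => dle.
  have /eqP E : (U :&: lker f)%VS == U by rewrite eqEdim capvSl dle.
  have := memv_pick U; rewrite -{2}E memv_cap memv_ker fE => /andP[_].
  by rewrite (negPf ui).
- by move=> c; rewrite memv_cap => /andP[cU _]; apply: U0.
exists (i :: s) => c cU /= /andP[ci cs]; apply: sP => //.
by rewrite memv_cap cU memv_ker fE.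
Qed.

(** The matrix of finitely many of the functionals is row free; a right inverse writes each
    coordinate as a combination of them. *)
Lemma dual_functionals (T : finType) (l : I -> T -> K) :
  (forall c : T -> K, (forall i, \sum_t c t * l i t = 0) -> forall t, c t = 0) ->
  exists Phi : T -> seq (K * I), forall t t',
    \sum_(bi <- Phi t) bi.1 * l bi.2 t' = (t == t')%:R.
Proof.
move=> H; pose k := #|T|.
pose u i : 'cV[K]_k := \col_j l i (enum_val j).
have [|s sP] := @finite_annihilator k u fullv.
  move=> c _ c0; apply/rowP => j; rewrite mxE.
  rewrite -[j]enum_valK; apply: (H (fun t => c 0 (enum_rank t))) => i.
  have := congr1 (fun M : 'M[K]_(1, 1) => M 0 0) (c0 i).
  rewrite !mxE => E; rewrite -[RHS]E (reindex (@enum_val T T)) /=.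
    by apply: eq_bigr => j' _; rewrite mxE enum_valK.
  by apply: onW_bij; apply: enum_val_bij.
pose A := \matrix_(j < k, m < size s) l (tnth (in_tuple s) m) (enum_val j).
have /row_freeP[B AB] : row_free A.
  apply: inj_row_free => c cA; apply: sP; first exact: memvf.
  apply/(all_tnthP (t := in_tuple s)) => /= m; apply/eqP/matrixP => i j.
  rewrite !ord1 !mxE; have /matrixP/(_ 0 m) := cA; rewrite !mxE => E.
  by rewrite -[RHS]E; apply: eq_bigr => j' _; rewrite !mxE.
exists (fun t => [seq (B m (enum_rank t), tnth (in_tuple s) m) | m <- enum 'I_(size s)]).
move=> t t'; rewrite big_map big_enum /=.
have /matrixP/(_ (enum_rank t') (enum_rank t)) := AB; rewrite !mxE.
rewrite (inj_eq enum_rank_inj) eq_sym => <-; apply: eq_bigr => m _.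
by rewrite !mxE enum_rankK mulrC.
Qed.
End Dual.

Section Forms.
Variable K : closedFieldType.

Definition supp_in n (A : pred (multinom n)) (F : mpoly n K) :=
  forall m, m \in msupp F -> A m.

Lemma supp_inE n A (F : mpoly n K) : supp_in A F <-> forall m, F@_m != 0 -> A m.
Proof. by split=> H m; have := H m; rewrite mcoeff_msupp. Qed.

Section Supp.
Variables (n : nat) (A : pred (multinom n)).
Implicit Types F G : mpoly n K.

Lemma supp_in0 : supp_in A (0 : mpoly n K).
Proof. by apply/supp_inE => m; rewrite mcoeff0 eqxx. Qed.
Lemma supp_inX m : A m -> supp_in A (mpolyX K m).
Proof. by move=> Am m'; rewrite msuppX inE => /eqP ->. Qed.
Lemma supp_inD F G : supp_in A F -> supp_in A G -> supp_in A (F + G).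
Proof. by move=> FA GA m /msuppD_le; rewrite mem_cat => /orP[/FA|/GA]. Qed.
Lemma supp_inZ c F : supp_in A F -> supp_in A (c *: F).
Proof. by move=> FA m /msuppZ_le /FA. Qed.
Lemma supp_in_sum (I : eqType) (r : seq I) (F : I -> mpoly n K) :
  (forall i, i \in r -> supp_in A (F i)) -> supp_in A (\sum_(i <- r) F i).
Proof.
elim: r => [|i r IH] H; first by rewrite big_nil; apply: supp_in0.
rewrite big_cons; apply: supp_inD; first by apply: H; rewrite mem_head.
by apply: IH => j jr; apply: H; rewrite in_cons jr orbT.
Qed.
End Supp.

(** [I] may be infinite, since a line is represented by its points. *)
Definition empty n (A : pred (multinom n)) (I : Type) (P : I -> 'rV[K]_n) (M : I -> int) :=
  forall F, supp_in A F -> (forall i, ordge F (P i) (M i)) -> F = 0.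

Section Open.
Variables (n d : nat) (A : pred (multinom n)).
Hypothesis Ad : forall m, A m -> (mdeg m < d)%N.

Let T : finType := {m : bmultinom n d | A m}.
Let mon (t : T) : multinom n := val (val t).

Lemma mon_inj : injective mon.
Proof. by move=> t t' E; do 2!apply: val_inj. Qed.

Lemma supp_in_expand (F : mpoly n K) : supp_in A F ->
  F = \sum_t F@_(mon t) *: mpolyX K (mon t).
Proof.
move=> FA; apply/mpolyP => m; rewrite raddf_sum /=.
have [mF|mF] := boolP (m \in msupp F); last first.
  rewrite memN_msupp_eq0 // big1 // => t _; rewrite mcoeffZ mcoeffX.
  by case: eqP => [->|]; rewrite ?mulr0 // memN_msupp_eq0 ?mul0r.
have Am := FA _ mF; pose t : T := @exist (bmultinom n d) (fun m => A m) (BMultinom (Ad Am)) Am.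
have tE : mon t = m by [].
rewrite (bigD1 t) //= mcoeffZ mcoeffX tE eqxx mulr1 big1 ?addr0 // => t' tt'.
by rewrite mcoeffZ mcoeffX -tE (inj_eq mon_inj) (negPf tt') mulr0.
Qed.

Lemma mcoeff_expand (c : T -> K) t :
  (\sum_t c t *: mpolyX K (mon t))@_(mon t) = c t.
Proof.
rewrite raddf_sum /= (bigD1 t) //= mcoeffZ mcoeffX eqxx mulr1 big1 ?addr0 //.
by move=> t' tt'; rewrite mcoeffZ mcoeffX (inj_eq mon_inj) (negPf tt') mulr0.
Qed.

Lemma supp_in_expanded (c : T -> K) : supp_in A (\sum_t c t *: mpolyX K (mon t)).
Proof.
by apply: supp_in_sum => t _; apply/supp_inZ/supp_inX; apply: (svalP t).
Qed.

Section Family.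
Variable J : Type.

Definition lin_family (L : J -> mpoly n K -> K) :=
  forall k c F G, L k (c *: F + G) = c * L k F + L k G.

Lemma lin_family_sum (L : J -> mpoly n K -> K) k (S : Type) (r : seq S) (c : S -> K) F :
  lin_family L -> L k (\sum_(t <- r) c t *: F t) = \sum_(t <- r) c t * L k (F t).
Proof.
move=> linL; elim: r => [|t r IH].
  rewrite !big_nil; have := linL k 1 0 0; rewrite scale1r addr0 mul1r.
  by move/eqP; rewrite -subr_eq0 opprD addrA subrr sub0r oppr_eq0 => /eqP.
by rewrite !big_cons linL IH.
Qed.

Lemma null_dual (L : J -> mpoly n K -> K) : lin_family L ->
  (forall F, supp_in A F -> (forall k, L k F = 0) -> F = 0) ->
  exists Phi : multinom n -> seq (K * J), forall m m', A m -> A m' ->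
    \sum_(bk <- Phi m) bk.1 * L bk.2 (mpolyX K m') = (m == m')%:R.
Proof.
move=> linL nullL.
have [c c0 t|Phi PhiP] := @dual_functionals _ _ T (fun k t => L k (mpolyX K (mon t))).
  rewrite -(mcoeff_expand c) (_ : \sum_t _ = 0) ?mcoeff0 //.
  by apply: nullL; [exact: supp_in_expanded|move=> k; rewrite lin_family_sum].
pose tm m (Am : A m) : T := @exist (bmultinom n d) (fun m => A m) (BMultinom (Ad Am)) Am.
exists (fun m => if @idP (A m) is ReflectT Am then Phi (tm m Am) else [::]) => m m' Am Am'.
case: {-}_ / (@idP (A m)) => // {}Am.
by have := PhiP (tm m Am) (tm m' Am'); rewrite -(inj_eq mon_inj).
Qed.

(** The combinations of conditions that extract the coefficients at [a0] are kept fixed while the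
    conditions move to [a]. Their matrix [B a] is regular in [a] and the identity at [a0]; where its
    determinant is nonzero, the conditions at [a] still determine all coefficients. *)
Lemma null_open W (reg : (W -> K) -> Prop) (L : W -> J -> mpoly n K -> K) (a0 : W) :
  regalg reg -> (forall a, lin_family (L a)) ->
  (forall k m, A m -> reg (fun a => L a k (mpolyX K m))) ->
  (forall F, supp_in A F -> (forall k, L a0 k F = 0) -> F = 0) ->
  exists phi, [/\ reg phi, phi a0 != 0 & forall a, phi a != 0 ->
    forall F, supp_in A F -> (forall k, L a k F = 0) -> F = 0].
Proof.
move=> H linL rL nullL.
have [Phi PhiP] := null_dual (linL a0) nullL.
pose B a : 'M[K]_#|T| := \matrix_(t', t) \sum_(bk <- Phi (mon (enum_val t)))
   bk.1 * L a bk.2 (mpolyX K (mon (enum_val t'))).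
have Amon t : A (mon t) by apply: (svalP t).
exists (fun a => \det (B a)); split.
- apply: (reg_det H) => t' t.
  apply: (@reg_ext _ _ _ (fun a => \sum_(bk <- Phi (mon (enum_val t)))
    bk.1 * L a bk.2 (mpolyX K (mon (enum_val t'))))) => [a|]; first by rewrite mxE.
  by apply: (reg_sum H) => bk; apply: (reg_mul H); [apply: (reg_cst H)|apply: rL].
- rewrite (_ : B a0 = 1%:M) ?det1 ?oner_neq0 //; apply/matrixP => t' t.
  by rewrite !mxE PhiP // (inj_eq mon_inj) (inj_eq enum_val_inj) eq_sym.
move=> a detB F FA FM.
suff F0 t : F@_(mon t) = 0.
  by rewrite (supp_in_expand FA) big1 // => t _; rewrite F0 scale0r.
pose c : 'rV[K]_#|T| := \row_j F@_(mon (enum_val j)).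
have cB : c *m B a = 0.
  apply/rowP => t0; rewrite !mxE.
  under eq_bigr => j _ do rewrite !mxE mulr_sumr.
  rewrite exchange_big big1 //= => bk _.
  under eq_bigr => j _ do rewrite mulrCA.
  have := FM bk.2; rewrite {1}(supp_in_expand FA) lin_family_sum //.
  rewrite (reindex (@enum_val T T)) /=.
    by rewrite -mulr_sumr => ->; rewrite mulr0.
  by apply: onW_bij; apply: enum_val_bij.
have Bu : B a \in unitmx by rewrite unitmxE unitfE.
have : c = 0 by rewrite -[c](mulmxK Bu) cB mul0mx.
by move/rowP/(_ (enum_rank t)); rewrite !mxE enum_rankK.
Qed.

End Family.

Section Jets.
Variables (I : Type) (M : I -> int).

Definition jetcoef (P : I -> 'rV[K]_n) (k : I * 'rV[{poly K}]_n * nat) (F : mpoly n K) : K :=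
  if (k.2%:Z < M k.1.1) then (psub F (jet (P k.1.1) k.1.2))`_k.2 else 0.

Lemma jetcoefP P F : (forall i, ordge F (P i) (M i)) <-> forall k, jetcoef P k F = 0.
Proof.
split=> [FM k|FM i y j jM].
  by case: k => -[i y] j; rewrite /jetcoef /=; case: (ltP j%:Z) => // jM; apply: FM.
by have := FM (i, y, j); rewrite /jetcoef /= jM.
Qed.

Lemma lin_jetcoef P : lin_family (jetcoef P).
Proof.
move=> k c F G; rewrite /jetcoef; case: (ltP k.2%:Z) => _; last by rewrite mulr0 addr0.
by rewrite psubD psubZ coefD coefCM.
Qed.

Lemma reg_jetcoef W (reg : (W -> K) -> Prop) (P : W -> I -> 'rV[K]_n) k F :
  regalg reg -> (forall i c, reg (fun a => P a i 0 c)) ->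
  reg (fun a => jetcoef (P a) k F).
Proof.
move=> H rP; rewrite /jetcoef; case: (ltP k.2%:Z) => _; last exact: (reg_cst H).
by apply: (regp_jet H) => i; apply: rP.
Qed.

Lemma empty_open W (reg : (W -> K) -> Prop) (P : W -> I -> 'rV[K]_n) (a0 : W) :
  regalg reg -> (forall i c, reg (fun a => P a i 0 c)) -> empty A (P a0) M ->
  exists phi, [/\ reg phi, phi a0 != 0 & forall a, phi a != 0 -> empty A (P a) M].
Proof.
move=> H rP PM.
have [||F FA /jetcoefP FP|phi [rphi phi0 phiP]] :=
  @null_open _ _ reg (fun a => jetcoef (P a)) a0 H.
- by move=> a; apply: lin_jetcoef.
- by move=> k m _; apply: reg_jetcoef.
- exact: PM.
by exists phi; split=> // a /phiP aP F FA /jetcoefP FP; apply: aP.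
Qed.

End Jets.

Lemma sum_msupp (V : zmodType) (F : mpoly n K) (h : multinom n -> V) :
  supp_in A F -> (forall m, F@_m = 0 -> h m = 0) ->
  \sum_(m <- msupp F) h m = \sum_(t : {m : bmultinom n d | A m}) h (val (val t)).
Proof.
move=> FA h0; rewrite (bigID (fun t => mon t \in msupp F)) /= addrC [X in X + _]big1 ?add0r; last first.
  by move=> t tF; apply/h0/memN_msupp_eq0.
rewrite -[RHS]big_filter -(big_map mon xpredT h); apply: perm_big.
apply: uniq_perm; first exact: msupp_uniq.
  by rewrite (map_inj_uniq mon_inj) filter_uniq // index_enum_uniq.
move=> m; apply/idP/mapP => [mF|[t]]; last by rewrite mem_filter => /andP[tF _] ->.
exists (@exist (bmultinom n d) (fun m => A m) (BMultinom (Ad (FA _ mF))) (FA _ mF)) => //.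
by rewrite mem_filter mem_index_enum andbT.
Qed.

End Open.

(* If F satisfies Q after rescaling by t^w, then for each m of weight < N a
   combination of these conditions, divided by t^(w m), reads F@_m = O(t); at
   t = 0 this leaves the forms of weight >= N. *)
Lemma empty_degenerate n d (A : pred (multinom n)) (w : multinom n -> nat) (N : nat)
    (I I' : Type) (P : I -> 'rV[K]_n) M (Q : I' -> 'rV[K]_n) M' :
  (forall m, A m -> (mdeg m < d)%N) ->
  empty [pred m | A m && (w m < N)%N] Q M' ->
  empty [pred m | A m && (N <= w m)%N] P M ->
  exists2 t, t != 0 & forall F, supp_in A F -> (forall i, ordge F (P i) (M i)) ->
    (forall i, ordge (\sum_(m <- msupp F) (F@_m * t ^+ w m) *: mpolyX K m) (Q i) (M' i)) ->
    F = 0.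
Proof.
move=> Ad lowQ highP.
have lowd m : [pred m | A m && (w m < N)%N] m -> (mdeg m < d)%N by case/andP => /Ad.
have [F FA /jetcoefP FQ|Phi PhiP] := null_dual lowd (@lin_jetcoef _ _ M' Q).
  exact: lowQ.
pose phi m m' := \sum_(bk <- Phi m) bk.1 * jetcoef M' Q bk.2 (mpolyX K m').
pose T : finType := {m : bmultinom n d | A m}.
pose mon (t : T) : multinom n := val (val t).
(* For t != 0, [inl m] is a combination of the rescaled conditions divided by t^(w m). The truncated
   exponent does no harm: [phi m] is the Kronecker delta on monomials of weight < N, and the others
   have weight > w m, so that their terms vanish at t = 0. *)
pose L t (k : multinom n + (I * 'rV[{poly K}]_n * nat)) F : K :=
  match k with
  | inl m => if A m && (w m < N)%N
             then \sum_u F@_(mon u) * (t ^+ (w (mon u) - w m) * phi m (mon u)) else 0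
  | inr k => jetcoef M P k F
  end.
have [|[m|k] m' _|F FA FL|f [rf f0 fP]] := @null_open n d A Ad _ K (@reg1 K) L 0 (reg1_alg K).
- move=> t [m|k] c F G /=; last exact: lin_jetcoef.
  case: ifP => _; last by rewrite mulr0 addr0.
  rewrite mulr_sumr -big_split; apply: eq_bigr => u _ /=.
  by rewrite mcoeffD mcoeffZ mulrDl -mulrA.
- rewrite /L; case: (A m && (w m < N)%N); last exact: (reg_cst (reg1_alg K)).
  apply: (reg_sum (reg1_alg K)) => u; apply: (reg_mul (reg1_alg K)); first exact: (reg_cst (reg1_alg K)).
  apply: (reg_mul (reg1_alg K)); last exact: (reg_cst (reg1_alg K)).
  by apply: (reg_exp (reg1_alg K)); apply: (reg1_id K).
- exact: (reg_cst (reg1_alg K)).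
- apply: highP; last by apply/(jetcoefP M) => k; apply: (FL (inr k)).
  apply/supp_inE => m Fm /=; have Am : A m by apply: FA; rewrite mcoeff_msupp.
  rewrite Am /= leqNgt; apply/negP => wm.
  have := FL (inl m); rewrite /= Am wm /=.
  pose u : T := @exist (bmultinom n d) (fun m => A m) (BMultinom (Ad _ Am)) Am.
  rewrite (bigD1 u) //= subnn expr0 mul1r /phi PhiP /= ?Am // eqxx mulr1 big1 ?addr0.
    by move/eqP; rewrite (negPf Fm).
  move=> u' u'u; have mu' : mon u' != m by apply: contraNneq u'u => /(@mon_inj n d A u' u) ->.
  have [wu|wu] := ltnP (w (mon u')) N; last first.
    by rewrite expr0n subn_eq0 leqNgt (leq_trans wm wu) mul0r mulr0.
  by rewrite PhiP /= ?Am // ?(svalP u') // eq_sym (negPf mu') !mulr0.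
have [t [ft t0]] := reg1_nonroot rf (reg1_id K) f0 (oner_neq0 K).
exists t => // F FA FP FQ; apply: (fP t ft) => // -[m|k]; last first.
  by move: k; apply/(jetcoefP M).
rewrite /=; case: ifP => // /andP[Am wm].
apply: (mulfI (expf_neq0 (w m) t0)); rewrite mulr0.
transitivity (\sum_(bk <- Phi m) bk.1 * jetcoef M' Q bk.2
  (\sum_(m <- msupp F) (F@_m * t ^+ w m) *: mpolyX K m)); last first.
  by rewrite big1 // => bk _; have /jetcoefP -> := FQ; rewrite mulr0.
under [RHS]eq_bigr => bk _ do rewrite (lin_family_sum _ _ _ _ (@lin_jetcoef _ _ M' Q)) mulr_sumr.
rewrite exchange_big /= (sum_msupp Ad FA); last first.
  by move=> m' Fm'; rewrite big1 // => bk _; rewrite Fm' !mul0r mulr0.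
rewrite mulr_sumr; apply: eq_bigr => u _; rewrite -/(mon u).
under [RHS]eq_bigr => bk _ do rewrite mulrCA.
rewrite -mulr_sumr -/(phi m (mon u)).
have [wu|wu] := ltnP (w (mon u)) N; last first.
  by rewrite mulrCA !mulrA -[in RHS](subnK (leq_trans (ltnW wm) wu)) exprD; ring.
rewrite /phi PhiP /= ?Am //; last by rewrite (svalP u).
by case: eqP => [->|]; rewrite ?mulr0 // subnn expr0; ring.
Qed.

End Forms.

(** * Forms *)

Section Forms.
Variable K : closedFieldType.

(* The zero form is the only form of negative degree. *)
Definition degree_is n (D : int) : pred (multinom n) := [pred m | (mdeg m)%:Z == D].

Local Notation isform D F := (supp_in (degree_is D) F).

Lemma degree_isE n (D : int) (m : multinom n) : degree_is D m = ((mdeg m)%:Z == D).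
Proof. by []. Qed.

Lemma degree_is_bounded n (D : int) (m : multinom n) :
  degree_is D m -> (mdeg m < (absz D).+1)%N.
Proof. by move=> /= /eqP; lia. Qed.

Section OneN.
Variable n : nat.
Implicit Types (F G : mpoly n K) (D E : int) (x : 'rV[K]_n) (S : pred 'I_n).

Lemma isform_neg D F : D < 0 -> isform D F -> F = 0.
Proof.
move=> D0 FD; apply: msuppnil0; case E: (msupp F) => [//|m s].
by have := FD m; rewrite E mem_head => /(_ isT) /eqP /=; lia.
Qed.

Lemma isformM D E F G : isform D F -> isform E G -> isform (D + E) (F * G).
Proof.
move=> FD GE m /msuppM_le /allpairsP[[m1 m2] /= [/FD /eqP <- /GE /eqP <- ->]].
by rewrite degree_isE mdegD PoszD.
Qed.

Lemma isform1 : isform 0 (1 : mpoly n K).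
Proof. by rewrite -mpolyX0; apply: supp_inX; rewrite degree_isE mdeg0. Qed.

Lemma isformXn D F k : isform D F -> isform (D * k%:Z) (F ^+ k).
Proof.
move=> FD; elim: k => [|k IH]; first by rewrite mulr0 expr0; apply: isform1.
by rewrite exprS (_ : _ * _ = D + D * k%:Z); [apply: isformM|lia].
Qed.

Lemma isform_prod (I : Type) (r : seq I) (D : I -> int) (F : I -> mpoly n K) :
  (forall i, isform (D i) (F i)) -> isform (\sum_(i <- r) D i) (\prod_(i <- r) F i).
Proof.
move=> H; elim: r => [|i r IH]; first by rewrite !big_nil; apply: isform1.
by rewrite !big_cons; apply: isformM.
Qed.

Lemma isformXU i : isform 1 (mpolyX K (@mnm1 n i)).
Proof. by apply: supp_inX; rewrite degree_isE mdeg1. Qed.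

Lemma isformN D F : isform D F -> isform D (- F).
Proof. by rewrite -scaleN1r; apply: supp_inZ. Qed.

Lemma isform_msub n' (k : 'I_n' -> mpoly n K) (F : mpoly n' K) D (e : int) :
  isform D F -> (forall i, isform e (k i)) -> isform (D * e) (msub k F).
Proof.
move=> FD ke; rewrite msubE; apply: supp_in_sum => m /FD /= /eqP <-; apply: supp_inZ.
rewrite mdegE (big_morph Posz PoszD (erefl 0%:Z)) mulr_suml; apply: isform_prod => i.
by rewrite mulrC; apply: isformXn.
Qed.

Definition wt S (m : multinom n) : nat := \sum_(i | S i) m i.

Lemma mdeg_wt c m : mdeg m = (m c + wt (fun i => i != c) m)%N.
Proof. by rewrite mdegE (bigD1 c). Qed.

Lemma ordge_wt F S x (M : int) : (forall i, S i -> x 0 i = 0) ->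
  (forall m, m \in msupp F -> M <= (wt S m)%:Z) -> ordge F x M.
Proof.
move=> x0 FM; rewrite [F]mpolyE; apply: ordge_sum => m /FM mM.
apply: ordgeZ => y; rewrite psubX; apply: vge_le mM _.
rewrite /wt (big_morph Posz PoszD (erefl 0%:Z)) [X in vge _ X]big_mkcond; apply: vge_prod => i.
case: ifP => Si; last exact: vge_npos.
by rewrite mxE (x0 i Si) add0r -[X in vge _ X]mulr1; apply/vgeX/vge_mulX.
Qed.

(** Along the arc with coordinates T z_i for i in [S] and z_i otherwise, the coefficient of T^k is
    the part of [S]-weight k evaluated at z. For k < M it vanishes wherever [q] does not, so this
    part is zero. *)
Lemma wt_ordge F S (M : int) (q : mpoly n K) : q != 0 ->
  (forall z : 'rV[K]_n, meval (z 0) q != 0 ->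
     ordge F (\row_i if S i then 0 else z 0 i) M) ->
  forall m, m \in msupp F -> M <= (wt S m)%:Z.
Proof.
move=> q0 H m; rewrite leNgt mcoeff_msupp; apply: contraNN => mM.
pose G := \sum_(m' <- msupp F | wt S m' == wt S m) F@_m' *: mpolyX K m'.
have -> : F@_m = G@_m.
  rewrite /G raddf_sum /=.
  have [mF|mF] := boolP (m \in msupp F).
    rewrite big_mkcond (bigD1_seq m) ?msupp_uniq //= eqxx mcoeffZ mcoeffX eqxx mulr1.
    rewrite big1 ?addr0 // => m' m'm; case: ifP => // _.
    by rewrite mcoeffZ mcoeffX (negPf m'm) mulr0.
  rewrite memN_msupp_eq0 // big1_seq // => m' /andP[_ m'F]; rewrite mcoeffZ mcoeffX.
  by case: eqP => [E|]; rewrite ?mulr0 //; rewrite -E m'F in mF.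
apply/eqP; rewrite (_ : G = 0) ?mcoeff0 //; apply: (mpoly_eq0_off q0) => z qz.
have := H z qz (\row_i if S i then (z 0 i)%:P else 0) (wt S m) mM.
rewrite psubE coef_sum /G raddf_sum /= => E; rewrite -[RHS]E big_mkcond /=.
apply: eq_bigr => m' _; rewrite mevalZ mevalX coefCM.
rewrite (_ : \prod_i _ = (\prod_i (z 0 i) ^+ m' i)%:P * 'X^(wt S m')).
  by rewrite coefCM coefXn eq_sym; case: eqP; rewrite ?mulr1 ?mulr0.
have -> : wt S m' = (\sum_i if S i then m' i else 0)%N by rewrite /wt big_mkcond.
rewrite rmorph_prod /= -prodrXr -big_split /=.
apply: eq_bigr => i _; rewrite !mxE rmorphXn; case: ifP => Si.
  by rewrite add0r exprMn mulrC.
by rewrite mulr0 addr0 expr0 mulr1.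
Qed.

Lemma ordge_scale D F x (M : int) (l : K) : isform D F -> l != 0 ->
  ordge F x M -> ordge F (l *: x) M.
Proof.
move=> FD l0 FM; have [D0|D0] := ltP D 0.
  by rewrite (isform_neg D0 FD); apply: ordge0.
pose k i := l^-1 *: mpolyX K (@mnm1 n i).
have : ordge (msub k F) (l *: x) M.
  apply: ordge_msub; congr (ordge F _ M): FM; apply/rowP => i.
  by rewrite !mxE mevalZ mevalXU mxE mulrA mulVf ?mul1r.
suff -> : msub k F = l^-1 ^+ (absz D) *: F.
  by move/(ordgeZ (l ^+ absz D)); rewrite scalerA -exprMn mulfV // expr1n scale1r.
rewrite msubE [in RHS](mpolyE F) scaler_sumr; apply: eq_big_seq => m /FD /eqP mD.
rewrite /k; under eq_bigr => i _ do rewrite exprZn.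
rewrite scaler_prod -mpolyXE_id prodrXr /= -mdegE (_ : mdeg m = absz D) ?scalerA 1?mulrC //.
by lia.
Qed.

(** At a vertex a multiplicity becomes a bound on exponents, which monomial substitutions and
    degenerations can handle. *)
Lemma ordge_vertex D F c (M : int) : isform D F ->
  ordge F (delta_mx 0 c) M <-> forall m, m \in msupp F -> (m c)%:Z <= D - M.
Proof.
move=> FD; split=> [FM m mF|FM].
  have := FD m mF; rewrite degree_isE (mdeg_wt c) => /eqP <-.
  suff : M <= (wt (fun i => i != c) m)%:Z by lia.
  move: m mF; apply: (@wt_ordge F _ M (mpolyX K (mnm1 c))).
    by rewrite -msupp_eq0 msuppX.
  move=> z; rewrite mevalXU => zc.
  rewrite (_ : \row_i _ = z 0 c *: delta_mx 0 c); first by apply: (ordge_scale FD).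
  by apply/rowP => i; rewrite !mxE /= mulr_natr; case: eqP => [->|].
apply: (@ordge_wt _ (fun i => i != c)) => [i ic|m mF].
  by rewrite mxE (negPf ic) andbF.
by have := FM m mF; have := FD m mF; rewrite degree_isE (mdeg_wt c) => /eqP <-; lia.
Qed.

Lemma relabel_eq0 n' (h : multinom n -> multinom n') F :
  {in msupp F &, injective h} ->
  \sum_(m <- msupp F) F@_m *: mpolyX K (h m) = 0 -> F = 0.
Proof.
move=> hinj F0; apply: msuppnil0; case E: (msupp F) => [//|m s].
have mF : m \in msupp F by rewrite E mem_head.
move/(congr1 (mcoeff (h m))): F0; rewrite mcoeff0 raddf_sum /=.
rewrite (bigD1_seq m) ?msupp_uniq //= mcoeffZ mcoeffX eqxx mulr1 big1_seq.
  by move: mF; rewrite mcoeff_msupp addr0 => /negPf Fm /eqP; rewrite Fm.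
move=> m' /andP[m'm m'F]; rewrite mcoeffZ mcoeffX.
by case: eqP => [/hinj E'|]; rewrite ?mulr0 //; rewrite E' ?eqxx in m'm.
Qed.

Lemma mpolyX_factor F (u : multinom n) : (forall m, m \in msupp F -> mpoly.lem u m) ->
  F = mpolyX K u * \sum_(m <- msupp F) F@_m *: mpolyX K (mnm_sub m u).
Proof.
move=> uF; rewrite [LHS]mpolyE mulr_sumr; apply: eq_big_seq => m /uF um.
by rewrite -scalerAr -mpolyXD; congr (_ *: mpolyX K _); rewrite addmC submK.
Qed.

Lemma empty_mulmx D (I : Type) (P : I -> 'rV[K]_n) M (g : 'M[K]_n) : g \in unitmx ->
  empty (degree_is D) P M -> empty (degree_is D) (fun i => P i *m g) M.
Proof.
move=> gu PM F FD FP; pose k i := \sum_j g j i *: mpolyX K (@mnm1 n j).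
have kE x i : meval (x 0) (k i) = (x *m g) 0 i.
  rewrite /k raddf_sum mxE /=; apply: eq_bigr => j _.
  by rewrite mevalZ mevalXU mulrC.
have F0 : msub k F = 0.
  apply: PM => [|i].
    rewrite -[D]mulr1; apply: isform_msub => // i; rewrite /k.
    by apply: supp_in_sum => j _; apply/supp_inZ/isformXU.
  apply: ordge_msub; rewrite (_ : \row_i _ = P i *m g) //.
  by apply/rowP => c; rewrite mxE kE.
apply: mpoly_eq0 => x; have := meval_msub k F ((x *m invmx g) 0).
rewrite F0 meval0 => /esym; congr (_ = 0); apply: meval_eq => i.
by rewrite kE mulmxKV.
Qed.

End OneN.
End Forms.
Local Notation isform D F := (supp_in (degree_is D) F).

(** * Plane linear systems *)

Section Generic.
Variable K : closedFieldType.

(* For points of the plane, c i k is the k-th coordinate of the i-th point.  For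
   lines in space relative to the quadric (1, x, y, xy), c 0 j is the value of y
   on the j-th ruling line and (c 1 i, c 2 i) is the i-th point of the quadric. *)
Definition cfg := nat -> nat -> K.
Implicit Types (c : cfg) (Q : cfg -> Prop).

Definition cline c c' (s : K) : cfg := fun k i => c k i + s * (c' k i - c k i).

(* Restriction to affine lines is enough to meet two nonempty open sets. *)
Definition regc (f : cfg -> K) := forall c c', reg1 (fun s => f (cline c c' s)).

Lemma regc_alg : regalg regc.
Proof.
split=> [a c c'|f g rf rg c c'|f g rf rg c c'].
- exact: (reg_cst (reg1_alg K)).
- exact: (reg_add (reg1_alg K)).
- exact: (reg_mul (reg1_alg K)).
Qed.

Lemma regc_coord k i : regc (fun c => c k i).
Proof. by move=> c c'; apply: reg1_line. Qed.

Definition gen Q := exists phi,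
  [/\ regc phi, exists c, phi c != 0 & forall c, phi c != 0 -> Q c].

Lemma gen_ex Q : gen Q -> exists c, Q c.
Proof. by case=> phi [_ [c pc] H]; exists c; apply: H. Qed.

Lemma gen_mono Q Q' : (forall c, Q c -> Q' c) -> gen Q -> gen Q'.
Proof. by move=> QQ' [phi [r e H]]; exists phi; split=> // c /H /QQ'. Qed.

Lemma gen_true Q : (forall c, Q c) -> gen Q.
Proof.
move=> HQ; exists (fun=> 1); split=> //; first exact: (reg_cst regc_alg).
by exists (fun _ _ => 0); apply: oner_neq0.
Qed.

Lemma gen_and Q Q' : gen Q -> gen Q' -> gen (fun c => Q c /\ Q' c).
Proof.
case=> f [rf [c fc] fQ] [g [rg [c' gc'] gQ]].
exists (fun c => f c * g c); split; first exact: (reg_mul regc_alg).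
  have f0 : f (cline c c' 0) != 0.
    rewrite (_ : cline c c' 0 = c) //; apply/funext => k; apply/funext => i.
    by rewrite /cline mul0r addr0.
  have g1 : g (cline c c' 1) != 0.
    rewrite (_ : cline c c' 1 = c') //; apply/funext => k; apply/funext => i.
    by rewrite /cline mul1r addrC subrK.
  have [t [ft gt]] := reg1_nonroot (rf c c') (rg c c') f0 g1.
  by exists (cline c c' t); rewrite mulf_neq0.
by move=> a; rewrite mulf_eq0 negb_or => /andP[/fQ ? /gQ].
Qed.

Lemma gen_neq0 h c : regc h -> h c != 0 -> gen (fun c => h c != 0).
Proof. by move=> rh hc; exists h; split=> //; exists c. Qed.

Lemma gen_forall k (Q : nat -> cfg -> Prop) :
  (forall i, (i < k)%N -> gen (Q i)) -> gen (fun c => forall i, (i < k)%N -> Q i c).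
Proof.
elim: k => [|k IH] H; first exact: gen_true.
have := gen_and (IH _) (H k (ltnSn k)).
move=> /(_ (fun i ik => H i (ltnW ik))); apply: gen_mono => c [H1 H2] i.
by rewrite ltnS leq_eqVlt => /orP[/eqP ->|/H1].
Qed.

Lemma gen_empty n d (A : pred (multinom n)) I (P : cfg -> I -> 'rV[K]_n) M c0 :
  (forall m, A m -> (mdeg m < d)%N) -> (forall i k, regc (fun c => P c i 0 k)) ->
  empty A (P c0) M -> gen (fun c => empty A (P c) M).
Proof.
move=> Ad rP PM; have [phi [rphi phi0 phiP]] := empty_open Ad regc_alg rP PM.
by exists phi; split=> //; exists c0.
Qed.

End Generic.

Section Plane.
Variable K : closedFieldType.
Implicit Types (D : int) (Ms : seq int) (P : nat -> 'rV[K]_3).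

Definition mult Ms (i : nat) : int := nth 0 Ms i.

Definition empty2 D P Ms := empty (degree_is D) P (mult Ms).

(* For some points, equivalently for general ones. *)
Definition E2 D Ms := exists P, empty2 D P Ms.

Definition pt3 (c : cfg K) (i : nat) : 'rV[K]_3 := \row_k c i k.

Lemma E2_gen D Ms : E2 D Ms -> gen (fun c => empty2 D (pt3 c) Ms).
Proof.
move=> [P PM]; apply: (@gen_empty K 3 _ _ _ _ _ (fun i k => P i 0 (inord k))).
- exact: degree_is_bounded.
- move=> i k c c'; apply: reg_ext (regc_coord i k c c') => s; by rewrite mxE.
- rewrite (_ : pt3 _ = P) //; apply/funext => i; apply/rowP => k.
  by rewrite !mxE inord_val.
Qed.

(** The points are redistributed along [g]; it suffices that [f] injects those of positive
    multiplicity into the new list without lowering them. *)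
Lemma E2_map (f g : nat -> nat) D Ms Ms' :
  (forall i, 0 < mult Ms i -> g (f i) = i /\ mult Ms i <= mult Ms' (f i)) ->
  E2 D Ms -> E2 D Ms'.
Proof.
move=> fg [P PM]; exists (fun j => P (g j)) => F FD FP; apply: PM => // i.
have [Mi|/fg[gfi le]] := leP (mult Ms i) 0; first exact: ordge_npos.
by rewrite -[in P i]gfi; apply: ordge_le le (FP _).
Qed.

Lemma E2_cat D Ms Ms' : E2 D Ms -> E2 D (Ms ++ Ms').
Proof.
apply: (@E2_map id id) => i; rewrite /mult nth_cat.
by case: ltnP => // szM; rewrite nth_default.
Qed.

Lemma E2_perm D Ms Ms' : perm_eq Ms Ms' -> E2 D Ms -> E2 D Ms'.
Proof.
rewrite perm_sym => /(perm_iotaP 0)[Is pIs ->].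
apply: (@E2_map (fun i => index i Is) (nth 0%N Is)) => i Mi.
have iIs : i \in Is.
  rewrite (perm_mem pIs) mem_iota add0n ltnNge; apply: contraL Mi => szi.
  by rewrite /mult nth_default ?ltxx.
by rewrite nth_index // /mult (nth_map 0%N) ?nth_index // index_mem.
Qed.

Definition vtx (i : nat) : 'rV[K]_3 := delta_mx 0 (inord i).

Lemma E2_normal D Ms : E2 D Ms -> exists P,
  [/\ empty2 D P Ms, forall i, (i < 3)%N -> P i = vtx i &
      forall i, (3 <= i)%N -> forall k, P i 0 k != 0].
Proof.
move=> /E2_gen gE.
pose G (c : cfg K) := \matrix_(i < 3) pt3 c i.
have rG i j : regc (fun c => G c i j).
  by apply: reg_ext (@regc_coord K i j) => c; rewrite !mxE.
(* The adjugate stands in for the inverse, so that the transformed coordinates stay polynomial in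
   [c]. *)
have ra i j : regc (fun c => (\adj (G c)) i j).
  apply: (@reg_ext K (cfg K) (@regc K) (fun c : cfg K => cofactor (G c) j i : K)) => [c|].
    by rewrite mxE.
  apply: (reg_mul (regc_alg K)); first exact: (reg_cst (regc_alg K)).
  by apply: (reg_det (regc_alg K)) => i' j'; apply: reg_ext (rG (lift j i') (lift i j')) => c; rewrite !mxE.
pose c1 : cfg K := fun i k => if (i < 3)%N then (i == k)%:R else 1.
have G1 : G c1 = 1%:M by apply/matrixP => i j; rewrite !mxE /c1 ltn_ord.
have gdet : gen (fun c => \det (G c) != 0).
  apply: (@gen_neq0 K _ c1); first exact: (reg_det (regc_alg K)).
  by rewrite G1 det1 oner_neq0.
have gtor : gen (fun c => forall i, (i < size Ms)%N -> (3 <= i)%N ->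
   forall k, (k < 3)%N -> (pt3 c i *m \adj (G c)) 0 (inord k) != 0).
  apply: gen_forall => i _; have [i3|i3] := leqP 3 i; last by apply: gen_true.
  apply: (@gen_mono _ (fun c => forall k, (k < 3)%N ->
     (pt3 c i *m \adj (G c)) 0 (inord k) != 0)) => [c H _ //|].
  apply: gen_forall => k k3; apply: (@gen_neq0 K _ c1).
    apply: (@reg_ext K (cfg K) (@regc K) (fun c => \sum_(j < 3) c i j * (\adj (G c)) j (inord k))) => [c|].
      by rewrite [RHS]mxE; apply: eq_bigr => j _; rewrite [pt3 c i _ _]mxE.
    by apply: (reg_sum (regc_alg K)) => j; apply: (reg_mul (regc_alg K)) => //; apply: regc_coord.
  have -> : \adj (G c1) = 1%:M by rewrite G1 -[LHS]mul1mx mul_mx_adj det1.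
  by rewrite mulmx1 mxE /c1 ltnNge i3 oner_neq0.
have [c [[cE cdet] ctor]] := gen_ex (gen_and (gen_and gE gdet) gtor).
have Gu : G c \in unitmx by rewrite unitmxE unitfE.
(* Indices beyond the list carry no condition; the filler [const_mx 1] makes the last property hold
   for them too. *)
exists (fun i => if (i < maxn 3 (size Ms))%N then pt3 c i *m invmx (G c) else const_mx 1).
split.
- have Giu : invmx (G c) \in unitmx by rewrite unitmx_inv.
  move=> F FD FP; apply: (empty_mulmx Giu cE FD) => i.
  have := FP i; case: ltnP => //= szi _; apply: ordge_npos.
  by rewrite /mult nth_default // (leq_trans _ szi) // leq_maxr.
- move=> i i3; rewrite (leq_trans i3) ?leq_maxl //.
  have -> : pt3 c i = row (inord i) (G c) by apply/rowP => k; rewrite !mxE inordK.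
  by rewrite rowE -mulmxA mulmxV // mulmx1.
move=> i i3 k; case: ltnP => szi; last by rewrite mxE oner_neq0.
have iMs : (i < size Ms)%N by move: szi; rewrite leq_max ltnS leqNgt; lia.
have := ctor i iMs i3 k (ltn_ord k); rewrite inord_val; apply: contraNneq.
by rewrite /invmx Gu -scalemxAr mxE => /eqP; rewrite mulf_eq0 invr_eq0 (negPf cdet).
Qed.

End Plane.

(** * Quadratic transformations and collisions of points *)

Section Cremona.
Variable K : closedFieldType.
Implicit Types (D : int) (Ms : seq int) (P : nat -> 'rV[K]_3).

Lemma mcoeff_relabel n n' (h : multinom n -> multinom n') (F : mpoly n K) m' :
  m' \in msupp (\sum_(m <- msupp F) F@_m *: mpolyX K (h m)) ->
  exists2 m, m \in msupp F & m' = h m.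
Proof.
have H : supp_in (fun m' => m' \in map h (msupp F))
    (\sum_(m <- msupp F) F@_m *: mpolyX K (h m)).
  by apply: supp_in_sum => m mF; apply/supp_inZ/supp_inX/map_f.
by move=> /H /mapP.
Qed.

Lemma mdeg3 (m : multinom 3) : mdeg m = (m 0%R + m 1%R + m 2%:R%R)%N.
Proof.
rewrite mdegE !big_ord_recl big_ord0 addn0 addnA.
by congr (m _ + m _ + m _)%N; apply: val_inj.
Qed.

Lemma ord3_case (R : 'I_3 -> Prop) : R 0 -> R 1 -> R 2%:R -> forall c, R c.
Proof.
move=> R0 R1 R2 [[|[|[|//]]] lt].
- by rewrite (_ : Ordinal lt = 0) //; apply: val_inj.
- by rewrite (_ : Ordinal lt = 1) //; apply: val_inj.
- by rewrite (_ : Ordinal lt = 2%:R) //; apply: val_inj.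
Qed.

(** [G] is [F] composed with the standard quadratic map and freed from the powers of the variables.
    Its exponents D - m i - [mm i] are natural numbers by the vertex conditions on [F], and being at
    most D - [mm i] they satisfy those on [G]. Off the coordinate triangle monomials do not vanish,
    so the other multiplicities persist. *)
Theorem E2_cremona D m1 m2 m3 Ms (k := D - (m1 + m2 + m3)) :
  E2 K (D + k) [:: m1 + k, m2 + k, m3 + k & Ms] -> E2 K D [:: m1, m2, m3 & Ms].
Proof.
move=> /E2_normal[P [PE Pvtx Ptor]].
pose mm (i : 'I_3) := mult [:: m1, m2, m3 & Ms] i.
pose U (c : 'I_3) : multinom 3 := Multinom [tuple (i != c : nat) | i < 3].
have UE c i : U c i = (i != c) :> nat by rewrite /U multinomE tnth_mktuple.
pose kk (c : 'I_3) : mpoly 3 K := mpolyX K (U c).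
pose phi (p : 'rV[K]_3) : 'rV[K]_3 := \row_i meval (p 0) (kk i).
exists (fun i => if (i < 3)%N then vtx K i else phi (P i)) => F FD FP.
pose sg (m : multinom 3) : multinom 3 := Multinom [tuple (mdeg m - m i)%N | i < 3].
have sgE m i : sg m i = (mdeg m - m i)%N by rewrite /sg multinomE tnth_mktuple.
have kkF : msub kk F = \sum_(m <- msupp F) F@_m *: mpolyX K (sg m).
  rewrite msubE; apply: eq_bigr => m _; congr (_ *: _).
  rewrite mprodXnE; congr mpolyX; apply/mnmP => i.
  rewrite mnm_sumE sgE (mdeg_wt i) addKn /wt [RHS]big_mkcond.
  apply: eq_bigr => c _; rewrite mulmnE UE eq_sym.
  by case: eqP; rewrite ?mul0n ?mul1n.
have Fbd m i : m \in msupp F -> (m i)%:Z <= D - mm i.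
  move=> mF; have := FP i; rewrite ltn_ord /vtx inord_val.
  by move/(ordge_vertex _ _ FD); apply.
pose h (m : multinom 3) : multinom 3 := Multinom [tuple absz (D - (m i)%:Z - mm i)%R | i < 3].
have hE m i : m \in msupp F -> (h m i)%:Z = D - (m i)%:Z - mm i.
  by move=> mF; rewrite /h multinomE tnth_mktuple; have := Fbd m i mF; lia.
pose G : mpoly 3 K := \sum_(m <- msupp F) F@_m *: mpolyX K (h m).
(* Splitting each multiplicity into positive and negative parts keeps the identity [rel] among
   polynomials: a negative one contributes a factor on the other side. *)
pose pos : multinom 3 := Multinom [tuple absz (Num.max (mm i) 0)%R | i < 3].
pose neg : multinom 3 := Multinom [tuple absz (Num.max (- mm i) 0)%R | i < 3].
have rel : mpolyX K pos * G = mpolyX K neg * msub kk F.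
  rewrite kkF !mulr_sumr; apply: eq_big_seq => m mF.
  rewrite -!scalerAr -!mpolyXD; congr (_ *: mpolyX K _); apply/mnmP => i.
  rewrite !mnmDE /pos /neg !multinomE !tnth_mktuple.
  have := Fbd m i mF; have := FD m mF; rewrite degree_isE => /eqP.
  have : (m i <= mdeg m)%N by rewrite (mdeg_wt i) leq_addr.
  lia.
have GD : isform (D + k) G.
  move=> m' /mcoeff_relabel[m mF ->].
  rewrite degree_isE mdeg3 !PoszD !hE //; apply/eqP.
  by have := FD m mF; rewrite degree_isE mdeg3 /mm /mult /k /= => /eqP; lia.
have G0 : G = 0.
  apply: PE => // i.
  have [i3|i3] := ltnP i 3.
    rewrite Pvtx // /vtx; set c : 'I_3 := inord i.
    have ci : i = c by rewrite inordK.
    apply/(ordge_vertex _ _ GD) => m' /mcoeff_relabel[m mF ->].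
    by rewrite hE // ci; move: (c); apply: ord3_case; rewrite /mm /mult /=; lia.
  have := FP i; rewrite ltnNge i3 /= => FPi.
  have Gi : ordge (mpolyX K pos * G) (P i) (mult [:: m1, m2, m3 & Ms] i).
    rewrite rel -[mult _ _]add0r; apply: ordgeM; first exact: ordge_npos.
    exact: ordge_msub.
  have := ordge_div0 Gi; rewrite mevalX.
  have -> : mult [:: m1 + k, m2 + k, m3 + k & Ms] i = mult [:: m1, m2, m3 & Ms] i.
    by move: i3; case: (i) => [|[|[|?]]].
  by apply; apply/prodf_neq0 => c _; rewrite expf_neq0 // Ptor.
apply: (relabel_eq0 (h := h)) G0 => m m' mF m'F hmm; apply/mnmP => i.
have := hE m i mF; have := hE m' i m'F; rewrite hmm; lia.
Qed.

Lemma ordge_vertex_gt n D M (F : mpoly n K) c : D < M -> isform D F ->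
  ordge F (delta_mx 0 c) M -> F = 0.
Proof.
move=> DM FD /(ordge_vertex _ _ FD) FM; apply: msuppnil0.
case E: (msupp F) => [//|m s].
by have := FM m; rewrite E mem_head => /(_ isT); lia.
Qed.

Lemma E2_lt D Ms i : D < mult Ms i -> E2 K D Ms.
Proof.
move=> DM; exists (fun=> delta_mx 0 0) => F FD FP.
exact: ordge_vertex_gt DM FD (FP i).
Qed.

(* Cremona turns four m-fold points in degree D into one in degree 2D-3m < m. *)
Lemma E2_four D (m : int) : D < (m + m) -> E2 K D [:: m; m; m; m].
Proof.
by move=> Dm; apply: E2_cremona; apply: (@E2_lt _ _ 3); rewrite /mult /=; lia.
Qed.

Lemma msub_rescale (t : K) (F : mpoly 3 K) :
  msub (fun i : 'I_3 => (if i == 0 then 1 else t) *: mpolyX K (mnm1 i)) F =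
  \sum_(m <- msupp F) (F@_m * t ^+ wt (fun i => i != 0) m) *: mpolyX K m.
Proof.
rewrite msubE; apply: eq_bigr => m _; rewrite -scalerA; congr (_ *: _).
under eq_bigr => i _ do rewrite exprZn.
rewrite scaler_prod -mpolyXE_id; congr (_ *: _).
rewrite (bigID (fun i : 'I_3 => i == 0)) /= big1 ?mul1r => [|i ->]; last by rewrite expr1n.
by rewrite /wt -prodrXr; apply: eq_bigr => i /negPf ->.
Qed.

(* The four points tend to the vertex e_0 under (X_0 : t X_1 : t X_2), and a
   plane curve of degree < 2m has no four general m-fold points. *)
Theorem E2_merge D (m : int) Ms :
  E2 K D ((m + m) :: Ms) -> E2 K D [:: m, m, m, m & Ms].
Proof.
have [m0|m0] := leP m 0.
  apply: (@E2_map K (addn 3) (subn^~ 3)) => -[|i] /=; rewrite /mult /=; lia.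
have [Dm|Dm] := ltP D ((m + m)); first by move=> _; apply/(@E2_cat K D [:: m; m; m; m])/E2_four.
(* Two zero multiplicities occupy the other vertices fixed by [E2_normal]. *)
move=> ED; have {}ED : E2 K D [:: (m + m), 0, 0 & Ms].
  apply: (E2_map (f := fun i => if i is j.+1 then j.+3 else 0%N)
    (g := fun i => if i is j.+3 then j.+1 else 0%N)) ED => -[|i] _; split=> //; exact: lexx.
have [P [PE Pvtx _]] := E2_normal ED.
have Ef : E2 K ((m + m) - 1) [:: m; m; m; m] by apply: E2_four; lia.
have gX : gen (fun c : cfg K => forall i, (i < 4)%N -> c i 0%N != 0).
  apply: gen_forall => i _; apply: (@gen_neq0 K _ (fun _ _ => 1)); last exact: oner_neq0.
  exact: regc_coord.
have [c [Qempty Q0]] := gen_ex (gen_and (E2_gen Ef) gX).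
pose w := wt (fun i : 'I_3 => i != 0).
have [||t t0 tP] := @empty_degenerate K 3 _ (degree_is D) w (absz ((m + m))) nat nat
   P (mult [:: 0, 0, 0 & Ms]) (pt3 c) (mult [:: m; m; m; m])
   (@degree_is_bounded 3 D).
(* A form of degree D and weight < 2m is X_0^e times a form of degree 2m - 1, which inherits the
   four m-fold points because they lie off X_0 = 0. *)
- move=> F FA FQ; have FD : isform D F by move=> m' /FA /andP[].
  pose e := absz (D - (m + m - 1))%R.
  pose u : multinom 3 := mnm_muln (mnm1 0) e.
  have uE i : u i = ((0%R == i) * e)%N by rewrite mulmnE mnm1E.
  have Fu m' : m' \in msupp F -> mpoly.lem u m'.
    move=> /FA /andP[]; rewrite degree_isE (mdeg_wt 0) -/(w m') => /eqP mD wm.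
    apply/mnm_lepP => i; rewrite uE; case: eqP => [<-|//]; rewrite mul1n /e.
    move: (m' 0) (w m') mD wm => a b mD wm.
    have {}mD : (a + b)%N = D :> int by [].
    by move: mD wm m0 Dm; clear; lia.
  have FE := mpolyX_factor Fu; set F1 := (X in _ = _ * X) in FE.
  suff F10 : F1 = 0 by rewrite FE F10 mulr0.
  apply: Qempty => [|i].
    apply: supp_in_sum => m' mF; apply/supp_inZ/supp_inX.
    have := FD _ mF; rewrite !degree_isE -{1}(submK (Fu _ mF)) mdegD mdegMn mdeg1 /e; lia.
  have [i4|i4] := ltnP i 4; last by apply: ordge_npos; rewrite /mult nth_default.
  have := FQ i; rewrite {1}FE => /ordge_div0; apply.
  rewrite mevalX; apply/prodf_neq0 => k _; rewrite uE.
  case: (0 =P k) => [<-|_]; last by rewrite mul0n expr0 oner_neq0.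
  by rewrite expf_neq0 // mxE Q0.
(* Weight >= 2m means that e_0 is a 2m-fold point. *)
- move=> F FA FP; have FD : isform D F by move=> m' /FA /andP[].
  apply: PE => // -[|[|[|i]]]; [|exact: ordge_npos|exact: ordge_npos|exact: (FP i.+3)].
  rewrite Pvtx // /vtx; apply/(ordge_vertex _ _ FD) => m' /FA /andP[]; rewrite degree_isE.
  rewrite (_ : inord 0 = 0) ?(mdeg_wt 0) -/(w m'); last by apply: val_inj; rewrite /= inordK.
  by rewrite /mult /=; lia.
exists (fun i => if (i < 4)%N then \row_k ((if k == 0 then 1 else t) * c i k) else P i.-1).
move=> F FD FP; apply: (tP F FD) => i.
  move: i => [|[|[|i]]]; [exact: ordge_npos|exact: ordge_npos|exact: ordge_npos|exact: (FP i.+4)].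
rewrite -msub_rescale.
have [i4|i4] := ltnP i 4; last by apply: ordge_npos; rewrite /mult nth_default.
apply: ordge_msub; have := FP i; rewrite i4.
have -> : mult [:: m, m, m, m & Ms] i = mult [:: m; m; m; m] i.
  by move: i i4 => [|[|[|[|]]]].
congr (ordge F _ _); apply/rowP => k.
by rewrite !mxE mevalZ mevalXU mxE.
Qed.

End Cremona.

(** * Algorithm T *)

Section AlgorithmT.
Variables (K : closedFieldType) (tau : rat).
Implicit Types (d f g : {poly rat}) (ms : seq {poly rat}).

Section AtT.
Variables N t : rat.

Definition intval f : bool := N * f.[t] \is a Num.int.
(** Exact under [intval]; the floor only serves as a total map to [int]. *)
Definition flr f : int := Num.floor (N * f.[t]).

Lemma flrK f : intval f -> (flr f)%:~R = N * f.[t].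
Proof. exact: floorK. Qed.

Lemma flr_eq f (k : int) : N * f.[t] = k%:~R -> intval f /\ flr f = k.
Proof. by rewrite /intval /flr => ->; rewrite intrKfloor intr_int. Qed.

Lemma flrD f g : intval f -> intval g -> intval (f + g) /\ flr (f + g) = flr f + flr g.
Proof.
move=> If Ig; apply: flr_eq.
by rewrite rmorphD /= !flrK // hornerD mulrDr.
Qed.

Lemma flrN f : intval f -> intval (- f) /\ flr (- f) = - flr f.
Proof.
by move=> If; apply: flr_eq; rewrite rmorphN /= flrK // hornerN mulrN.
Qed.

(** What is dropped at tau may be positive at t; this is sound because a system that is empty under
    fewer conditions is empty under more. *)
Lemma E2_stepT1 D ms ms1 : stepT1 tau ms ms1 ->
  E2 K D (map flr ms1) -> E2 K D (map flr ms).
Proof.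
move=> [pm _] E1; have pf : perm_eq (map flr ms1) (map flr [seq m <- ms | 0 < m.[tau]]).
  exact: perm_map.
have := E2_cat (map flr [seq m <- ms | ~~ (0 < m.[tau])]) (E2_perm pf E1).
by apply: E2_perm; rewrite -map_cat; apply: perm_map; rewrite perm_filterC.
Qed.

Lemma stepT1_sub ms ms1 : stepT1 tau ms ms1 -> {subset ms1 <= ms}.
Proof. by move=> [/perm_mem pm _] m; rewrite pm mem_filter => /andP[]. Qed.

Lemma runT_E2 d ms d' : runT tau d ms d' -> intval d -> all intval ms ->
  N * d'.[t] < 0 -> E2 K (flr d) (map flr ms).
Proof.
elim=> {d ms d'} [d ms m1 m2 m3 ms' k d' st _ kE _ IH|d ms ms1 m ms' d' st _ pm _ IH
  |d ms ms1 st _ _] Id Ims d'0.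
- have sub := stepT1_sub st; apply: (E2_stepT1 st) => /=.
  have I1 : intval m1 by apply: (allP Ims); apply: sub; rewrite !inE eqxx.
  have I2 : intval m2 by apply: (allP Ims); apply: sub; rewrite !inE eqxx orbT.
  have I3 : intval m3 by apply: (allP Ims); apply: sub; rewrite !inE eqxx !orbT.
  have I' : all intval ms'.
    by apply/allP => m mm; apply: (allP Ims); apply: sub; rewrite !inE mm !orbT.
  have [I12 E12] := flrD I1 I2; have [I123 E123] := flrD I12 I3.
  have [In En] := flrN I123; have [Ik Ek] := flrD Id In.
  rewrite -kE in Ik Ek.
  have [Idk Edk] := flrD Id Ik; have [I1k E1k] := flrD I1 Ik.
  have [I2k E2k] := flrD I2 Ik; have [I3k E3k] := flrD I3 Ik.
  apply: E2_cremona.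
  have -> : flr d - (flr m1 + flr m2 + flr m3) = flr k by rewrite Ek En E123 E12.
  rewrite -Edk -E1k -E2k -E3k; apply: IH => //.
  by rewrite /= I1k I2k I3k.
- have sub := stepT1_sub st; apply: (E2_stepT1 st).
  have Iall : all intval (m :: ms').
    apply/allP => m' mm; apply: (allP Ims); apply: sub; rewrite (perm_mem pm).
    by move: mm; rewrite !inE => /orP[/eqP ->|->]; rewrite ?eqxx ?orbT.
  have /andP[Im I'] := Iall.
  have [I2 E2m] := flrD Im Im.
  have pf : perm_eq (map flr [:: m, m, m, m & ms']) (map flr ms1).
    by apply: perm_map; rewrite perm_sym.
  apply: (E2_perm pf); apply: E2_merge; rewrite -E2m; apply: IH => //=.
  by rewrite mulr2n I2.
exists (fun=> 0) => F; move/isform_neg => -> //.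
by rewrite -(ltrz0 rat) flrK.
Qed.

End AtT.

Lemma runT_size d ms d' : runT tau d ms d' -> (size d <= 2)%N ->
  all (fun m : {poly rat} => (size m <= 2)%N) ms -> (size d' <= 2)%N.
Proof.
have sD f g : (size f <= 2)%N -> (size g <= 2)%N -> (size (f + g)%R <= 2)%N.
  by move=> sf sg; rewrite (leq_trans (size_polyD _ _)) // geq_max sf.
elim=> {d ms d'} [d ms m1 m2 m3 ms' k d' st _ kE _ IH|d ms ms1 m ms' d' st _ pm _ IH
  |d ms ms1 st _ _] // sd sms.
- have {}sms : all (fun m : {poly rat} => (size m <= 2)%N) [:: m1, m2, m3 & ms'].
    by apply/allP => m /(stepT1_sub st) /(allP sms).
  case/and4P: sms => s1 s2 s3 s'.
  have sk : (size k <= 2)%N by rewrite kE sD // size_polyN !sD.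
  by apply: IH; rewrite /= ?sD.
have : all (fun m : {poly rat} => (size m <= 2)%N) [:: m, m, m, m & ms'].
  by apply/allP => m' m'm; apply: (allP sms); apply: (stepT1_sub st); rewrite (perm_mem pm).
by case/and5P => s1 _ _ _ s'; apply: IH => //=; rewrite mulr2n sD.
Qed.

Lemma outputT_lt0 (qs : seq rat) d (t : rat) : (size d <= 2)%N ->
  0 <= t -> t < outputT qs d -> d.[t] < 0.
Proof.
move=> sd t0; rewrite /outputT.
have -> : d.[t] = d`_0 + d`_1 * t.
  by rewrite (horner_coef_wide _ sd) !big_ord_recl big_ord0 addr0 expr0 mulr1 expr1.
case: (leP 0 d`_0) => a0; first by move=> tt; have := le_lt_trans t0 tt; rewrite ltxx.
case: (leP d`_1 0) => b0 tq; first nra.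
have : t < - d`_0 / d`_1 by move: tq; rewrite bigmin_idl lt_min => /andP[].
by rewrite ltr_pdivlMr //; lra.
Qed.

(** Evaluated at t = i/N and scaled by N, the initial sequence of T belongs to degree D - 2i and
    ruling multiplicities M_j - i: the system left after i quadrics. The final degree is negative at
    t because t < t0. *)
Lemma algT_E2 (delta : rat) (qs : seq rat) (p : nat) (t0 : rat) (N : nat)
    (D : int) (Ms : seq int) (i : nat) :
  algT tau delta qs p t0 -> (0 < N)%N -> i%:R < N%:R * t0 ->
  D%:~R = N%:R * delta -> map intr Ms = map ( *%R N%:R) qs ->
  let S := \sum_(M <- Ms) M in let r := (size Ms)%:Z in
  E2 K (D + D - S + (r - 4) * i%:Z)
    [:: D - i%:Z * 2, D - S + (r - 2) * i%:Z & nseq (2 * p) N%:Z].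
Proof.
move=> [d run t0E] N0 iN DE ME S r.
have [t [tE Nt]] : exists t : rat, t = i%:R / N%:R /\ N%:R * t = i%:R.
  by exists (i%:R / N%:R); rewrite mulrCA mulfV ?mulr1 // pnatr_eq0 -lt0n.
have SE : S%:~R = N%:R * \sum_(q <- qs) q :> rat.
  rewrite mulr_sumr -(big_map ( *%R N%:R) xpredT id) -ME big_map /S.
  exact: (rmorph_sum (intmul 1)).
have rE : r = (size qs)%:Z.
  by have /(congr1 size) := ME; rewrite !size_map /r => ->.
have I1 : N%:R * (1 : {poly rat}).[t] = (N%:Z)%:~R by rewrite hornerC mulr1.
have Id : N%:R * (initial_degreeT delta qs).[t] = (D + D - S + (r - 4) * i%:Z)%:~R.
  rewrite /initial_degreeT !hornerE !(intrD, intrM, mulrNz) DE SE rE -!pmulrn -Nt.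
  ring.
have I2 : N%:R * (delta%:P - 2%:R *: 'X).[t] = (D - i%:Z * 2)%:~R.
  by rewrite !hornerE !(intrD, intrM, mulrNz) DE -pmulrn -Nt; ring.
have I3 : N%:R * ((delta - \sum_(q <- qs) q)%:P + ((size qs)%:R - 2%:R) *: 'X).[t] =
    (D - S + (r - 2) * i%:Z)%:~R.
  by rewrite !hornerE !(intrD, intrM, mulrNz) DE SE rE -!pmulrn -Nt; ring.
have [/= Id' Ed] := flr_eq Id; have [/= I2' E2'] := flr_eq I2.
have [/= I3' E3] := flr_eq I3; have [/= I1' E1] := flr_eq I1.
have := runT_E2 run Id'; rewrite Ed /initial_multsT /= E2' E3 map_nseq E1; apply.
  by rewrite I2' I3' /=; apply/allP => m /nseqP[->].
rewrite pmulr_rlt0 ?ltr0n //; apply: (@outputT_lt0 qs) => //.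
- have sL (a b : rat) : (size (a%:P + b *: 'X : {poly rat})%R <= 2)%N.
    rewrite (leq_trans (size_polyD _ _)) // geq_max (leq_trans (size_polyC_leq1 _)) //.
    by rewrite (leq_trans (size_scale_leq _ _)) // size_polyX.
  apply: (runT_size run); first exact: sL.
  rewrite /= -scaleNr !sL; apply/allP => m /nseqP[-> _]; by rewrite size_poly1.
- by rewrite tE divr_ge0 ?ler0n.
by rewrite -t0E tE ltr_pdivrMr ?ltr0n // mulrC.
Qed.

End AlgorithmT.

(** * Lines on a smooth quadric *)

Section BinomialDivision.
Variables (K : closedFieldType) (n : nat) (lam rho : multinom n) (a : K) (i0 : 'I_n).
Hypotheses (lam_gt0 : (0 < lam i0)%N) (rho0 : rho i0 = 0%N) (deg_eq : mdeg lam = mdeg rho).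
Let q := mpolyX K lam - a *: mpolyX K rho.

(** Replacing X^lam by a X^rho lowers the exponent of [i0], so the rewriting ends. It is applied to
    a line X_1 - b X_2 in the plane and to the quadric X_0 X_3 - X_1 X_2. *)
Lemma binomial_division D F : isform D F -> exists F' R,
  [/\ F = q * F' + R, isform (D - (mdeg lam)%:Z) F', isform D R &
      forall m, m \in msupp R -> ~~ mpoly.lem lam m].
Proof.
pose S (F : mpoly n K) := exists F' R,
  [/\ F = q * F' + R, isform (D - (mdeg lam)%:Z) F', isform D R &
      supp_in [pred m | ~~ mpoly.lem lam m] R].
have SD F1 F2 : S F1 -> S F2 -> S (F1 + F2).
  move=> [F1' [R1 [-> ? ? ?]]] [F2' [R2 [-> ? ? ?]]].
  exists (F1' + F2'), (R1 + R2); split; try exact: supp_inD.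
  by rewrite mulrDr addrACA.
have SZ c F1 : S F1 -> S (c *: F1).
  move=> [F1' [R1 [-> ? ? ?]]].
  exists (c *: F1'), (c *: R1); split; try exact: supp_inZ.
  by rewrite scalerDr scalerAr.
have S0 : S 0 by exists 0, 0; split; try exact: supp_in0; rewrite mulr0 addr0.
have SX m : degree_is D m -> S (mpolyX K m).
  have [k] := ubnP (m i0); elim: k m => // k IH m mk mD.
  have [lm|lm] := boolP (mpoly.lem lam m); last first.
    exists 0, (mpolyX K m); split; [by rewrite mulr0 add0r|exact: supp_in0| |].
      exact: supp_inX.
    exact: supp_inX.
  pose m' := mnm_sub m lam.
  have mE : m = mnm_add m' lam by rewrite submK.
  have XE : mpolyX K m = q * mpolyX K m' + a *: mpolyX K (mnm_add m' rho).
    by rewrite {1}mE !mpolyXD /q mulrBl -scalerAl [mpolyX K rho * _]mulrC subrK mulrC.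
  rewrite XE; apply: SD.
    exists (mpolyX K m'), 0; split; [by rewrite addr0| |exact: supp_in0|exact: supp_in0].
    by apply: supp_inX; move: mD; rewrite !degree_isE {1}mE mdegD PoszD => /eqP <-; rewrite addrK.
  apply/SZ/IH; last by move: mD; rewrite !degree_isE {1}mE !mdegD deg_eq.
  by move: mk; rewrite {1}mE !mnmDE rho0; lia.
move=> FD; have {}FD : forall m, m \in msupp F -> degree_is D m := FD.
rewrite [F]mpolyE; elim: (msupp F) FD => [|m s IH] FD; first by rewrite big_nil; apply: S0.
rewrite big_cons; apply: SD; first by apply: SZ; apply: SX; apply: FD; rewrite inE eqxx.
by apply: IH => m' m's; apply: FD; rewrite inE m's orbT.
Qed.

End BinomialDivision.

Section Quadric.
Variable K : closedFieldType.
Implicit Types (D : int) (Ms Ns : seq int) (c : cfg K).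

Definition row3 (x y z : K) : 'rV[K]_3 := \row_i nth 0 [:: x; y; z] i.
Definition row4 (x y z t : K) : 'rV[K]_4 := \row_i nth 0 [:: x; y; z; t] i.

Lemma vtxE i (k : 'I_3) : (i < 3)%N -> vtx K i 0 k = (k == i :> nat)%:R.
Proof. by move=> i3; rewrite mxE /= -(inj_eq val_inj) /= inordK. Qed.

Lemma line_factor D G (b : K) : isform D G ->
  (forall p0 p2, p2 != 0 -> meval (row3 p0 (b * p2) p2 0) G = 0) ->
  exists2 G', G = (mpolyX K (@mnm1 3 1) - b *: mpolyX K (mnm1 2%:R)) * G' & isform (D - 1) G'.
Proof.
move=> GD G0; pose lam : multinom 3 := mnm1 1.
have [|||F' [R [GE F'D RD Rlam]]] := @binomial_division K 3 lam (mnm1 2%:R) b 1 _ _ _ D G GD.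
- by rewrite mnm1E.
- by rewrite mnm1E.
- by rewrite !mdeg1.
rewrite mdeg1 in F'D; exists F' => //; rewrite {1}GE.
(* The remainder is free of X_1, so its value at [x] equals its value at a point of the line. *)
suff -> : R = 0 by rewrite addr0.
apply: (@mpoly_eq0_off _ _ R (mpolyX K (mnm1 2%:R))) => [|x].
  by rewrite -msupp_eq0 msuppX.
rewrite mevalXU => x2; have := G0 (x 0 0) _ x2.
rewrite GE mevalD mevalM mevalB mevalZ !mevalXU !mxE /= subrr mul0r add0r => <-.
rewrite !mevalE; apply: eq_big_seq => m /Rlam; rewrite lep1mP negbK => /eqP m1.
congr (_ * _); apply: eq_bigr; apply: ord3_case => _; rewrite !mxE //=.
by rewrite m1 !expr0.
Qed.

(* The first two points are those at infinity of the chart X_2 = 1. *)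
Definition aff c (i : nat) : 'rV[K]_3 :=
  match i with 0%N => vtx K 0 | 1%N => vtx K 1 | i.+2 => row3 (c 1%N i) (c 2%N i) 1 end.

Lemma E2_affine D A B Ns :
  E2 K D [:: A, B & Ns] -> gen (fun c => empty2 D (aff c) [:: A, B & Ns]).
Proof.
(* A third vertex of multiplicity 0 is inserted because [E2_normal] fixes three; the remaining
   points then have X_2 != 0. *)
move=> ED; have {}ED : E2 K D [:: A, B, 0 & Ns].
  apply: (E2_map (f := fun i => if i is j.+2 then j.+3 else i)
    (g := fun i => if i is j.+3 then j.+2 else i)) ED => -[|[|i]] _; split=> //; exact: lexx.
have [P [PE Pvtx Ptor]] := E2_normal ED.
pose c0 : cfg K := fun k i => P i.+3 0 (inord k.-1) / P i.+3 0 2%:R.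
apply: (@gen_empty _ _ _ _ _ _ _ c0); first exact: degree_is_bounded.
- move=> [|[|i]] k; [exact: (reg_cst (regc_alg K))|exact: (reg_cst (regc_alg K))|].
  apply: (@reg_ext K (cfg K) (@regc K) (fun c => nth 0 [:: c 1%N i; c 2%N i; 1] k)) => [c|].
    by rewrite mxE.
  move: k; apply: ord3_case; [exact: regc_coord|exact: regc_coord|].
  exact: (reg_cst (regc_alg K)).
move=> F FD FP; apply: PE => // -[|[|[|i]]].
- by rewrite Pvtx //; exact: (FP 0%N).
- by rewrite Pvtx //; exact: (FP 1%N).
- exact: ordge_npos.
have P2 : P i.+3 0 2%:R != 0 by apply: Ptor.
have -> : P i.+3 = P i.+3 0 2%:R *: aff c0 i.+2.
  apply/rowP; apply: ord3_case; rewrite !mxE /= /c0 /= ?mulr1 // mulrCA mulfV // mulr1;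
  by congr (P _ _ _); apply: val_inj; rewrite /= inordK.
by apply: (ordge_scale FD P2); apply: (FP i.+2).
Qed.

Lemma meval_ruling_form (x : 'rV[K]_3) (b : K) :
  meval (x 0) (mpolyX K (@mnm1 3 1) - b *: mpolyX K (mnm1 2%:R)) = x 0 1 - b * x 0 2%:R.
Proof. by rewrite mevalB mevalZ !mevalXU. Qed.

(* The factors of negative exponent M are multiplied in rather than divided out. *)
Lemma lines_division c (bs : seq (K * int)) Ns :
  uniq (map fst bs) ->
  (forall k b, (k < size Ns)%N -> b \in map fst bs -> c 2%N k != b) ->
  forall D A B G, isform D G -> ordge G (vtx K 0) A -> ordge G (vtx K 1) B ->
  (forall k, ordge G (aff c k.+2) (mult Ns k)) ->
  (forall b M, (b, M) \in bs -> forall p0 p2, p2 != 0 -> ordge G (row3 p0 (b * p2) p2) M) ->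
  let S := \sum_(bM <- bs) bM.2 in
  empty2 (D - S) (aff c) [:: A - S, B & Ns] -> G = 0.
Proof.
(* The arc in direction X_1 shows that the linear form has order at most 1 on its line, so dividing
   by it costs one unit of order there. *)
have jetl (x : 'rV[K]_3) (b : K) : x 0 1 - b * x 0 2%:R = 0 ->
  (psub (mpolyX K (@mnm1 3 1) - b *: mpolyX K (mnm1 2%:R))
    (jet x (delta_mx 0 1)))`_1 != 0.
  move=> x0; rewrite psubB psubZ !psubXU !mxE /=.
  rewrite mulr1 mulr0 addr0 coefB coefD !coefC coefCM coefC coefX /= mulr0 add0r subr0.
  exact: oner_neq0.
elim: bs => [|[b M] bs IH] /= ubs yb D A B G GD GA GB GN Gb.
  rewrite /= big_nil !subr0; apply => // -[|[|i]] //.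
  exact: (GN i).
rewrite big_cons /=; move: ubs => /andP[bbs ubs].
(* Inner induction on |M|. A copy of the line X_1 = b X_2 shifts the degree, the order at e_0 and
   [M] by one, while e_1 and the affine points of the list lie off the line. *)
have [k] := ubnP (absz M); elim: k M D A G GD GA Gb GB GN => // k IHk M D A G GD GA Gb GB GN Mk.
have Gbs b' M' : (b', M') \in bs -> b' != b /\
    forall p0 p2, p2 != 0 -> ordge G (row3 p0 (b' * p2) p2) M'.
  move=> bM; split; last by apply: Gb; rewrite in_cons bM orbT.
  by apply: contraNneq bbs => <-; apply/mapP; exists (b', M').
have GbM p0 p2 : p2 != 0 -> ordge G (row3 p0 (b * p2) p2) M.
  by apply: Gb; rewrite mem_head.
have yb' : forall k b', (k < size Ns)%N -> b' \in map fst bs -> c 2%N k != b'.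
  by move=> k' b' kN bb; apply: yb => //; rewrite in_cons bb orbT.
set S := \sum_(bM <- bs) bM.2.
have [M0|M0|M0] := ltgtP M 0.
- move=> E; pose l := mpolyX K (@mnm1 3 1) - b *: mpolyX K (mnm1 2%:R).
  have l0 : l != 0.
    apply/negP => /eqP l0; have := jetl 0 b; rewrite -/l l0 psub0 coef0 !mxE mulr0 subrr eqxx.
    by move=> /(_ erefl).
  suff : l * G = 0 by move/eqP; rewrite mulf_eq0 (negPf l0) => /eqP.
  have lpos p0 p2 : ordge l (row3 p0 (b * p2) p2) 1.
    by apply/ordge1P; rewrite /l meval_ruling_form !mxE subrr.
  apply: (IHk (M + 1) (D + 1) (A + 1)).
  + rewrite addrC; apply: isformM => //; apply: supp_inD; first exact: isformXU.
    exact/isformN/supp_inZ/isformXU.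
  + rewrite addrC; apply: ordgeM => //; apply/ordge1P.
    by rewrite /l meval_ruling_form !vtxE //= mulr0 subrr.
  + move=> b' M'; rewrite in_cons => /orP[/eqP[-> ->]|/Gbs[_ H]] p0 p2 p20.
      by rewrite addrC; apply: ordgeM; [apply: lpos|apply: GbM].
    by rewrite -[M']add0r; apply: ordgeM; [apply: ordge_npos|apply: H].
  + by rewrite -[B]add0r; apply: ordgeM; first exact: ordge_npos.
  + by move=> k'; rewrite -[mult _ _]add0r; apply: ordgeM; first exact: ordge_npos.
  + lia.
  + have -> : D + 1 - (M + 1 + S) = D - (M + S) by lia.
    by have -> : A + 1 - (M + 1 + S) = A - (M + S) by lia.
- have [|G' GE G'D] := line_factor GD (b := b).
    by move=> p0 p2 p20; apply/ordge1P; apply: ordge_le (GbM p0 p2 p20); lia.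
  move=> E; rewrite GE [X in _ * X](_ : _ = 0) ?mulr0 //.
  have div0 (x : 'rV[K]_3) N : x 0 1 - b * x 0 2%:R != 0 -> ordge G x N -> ordge G' x N.
    by rewrite GE => xb /ordge_div0; apply; rewrite meval_ruling_form.
  have div1 (x : 'rV[K]_3) N : x 0 1 - b * x 0 2%:R = 0 -> ordge G x N -> ordge G' x (N - 1).
    by rewrite GE => /jetl xb GxN; apply: ordge_div GxN xb.
  apply: (IHk (M - 1) (D - 1) (A - 1)) => //.
  + apply: div1 => //.
    by rewrite !vtxE //= mulr0 subrr.
  + move=> b' M'; rewrite in_cons => /orP[/eqP[-> ->]|/Gbs[b'b H]] p0 p2 p20.
      by apply: div1; [rewrite !mxE /= subrr|apply: GbM].
    apply: div0; last exact: H.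
    by rewrite !mxE /= -mulrBl mulf_neq0 // subr_eq0.
  + apply: div0 => //; rewrite !vtxE //= mulr0 subr0.
    exact: oner_neq0.
  + move=> k'; have [kN|kN] := ltnP k' (size Ns).
      apply: div0; last exact: GN.
      by rewrite !mxE /= mulr1 subr_eq0 yb // mem_head.
    by apply: ordge_npos; rewrite /mult nth_default.
  + lia.
  + have -> : D - 1 - (M - 1 + S) = D - (M + S) by lia.
    by have -> : A - 1 - (M - 1 + S) = A - (M + S) by lia.
rewrite M0 add0r; apply: IH => // b' M' /Gbs[_]; exact.
Qed.

End Quadric.

(** * Lines in space and the smooth quadric *)

Section Space.
Variable K : closedFieldType.
Implicit Types (D : int) (Ms Ns : seq int) (c : cfg K).

Lemma ord4_case (R : 'I_4 -> Prop) : R 0 -> R 1 -> R 2%:R -> R 3%:R -> forall i, R i.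
Proof.
move=> R0 R1 R2 R3 [[|[|[|[|//]]]] lt].
- by rewrite (_ : Ordinal lt = 0) //; apply: val_inj.
- by rewrite (_ : Ordinal lt = 1) //; apply: val_inj.
- by rewrite (_ : Ordinal lt = 2%:R) //; apply: val_inj.
- by rewrite (_ : Ordinal lt = 3%:R) //; apply: val_inj.
Qed.

Definition qpt (x y : K) : 'rV[K]_4 := row4 1 x y (x * y).
Definition ruling (b B : K) : 'rV[K]_4 := qpt B b.
Definition secant c (i : nat) (B : K) : 'rV[K]_4 :=
  let u := qpt (c 1%N i.*2) (c 2%N i.*2) in
  let v := qpt (c 1%N i.*2.+1) (c 2%N i.*2.+1) in u + B *: (v - u).

(** Only points of finite parameter are listed; emptiness under these conditions implies emptiness
    under vanishing on the whole lines. *)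
Definition pt4 c (k : nat * K + nat * K) : 'rV[K]_4 :=
  match k with inl (j, B) => ruling (c 0%N j) B | inr (i, B) => secant c i B end.

Definition mult4 Ms Ns (k : nat * K + nat * K) : int :=
  match k with inl (j, B) => mult Ms j | inr (i, B) => mult Ns i end.

Definition empty3 D c Ms Ns := empty (degree_is D) (pt4 c) (mult4 Ms Ns).

Definition E3 D Ms Ns := exists c, empty3 D c Ms Ns.

Lemma E3_gen D Ms Ns : E3 D Ms Ns -> gen (fun c => empty3 D c Ms Ns).
Proof.
move=> [c E]; apply: (gen_empty _ _ E); first exact: degree_is_bounded.
have rC := regc_coord (K := K); have rM := reg_mul (regc_alg K).
have rq f g i : regc f -> regc g -> regc (fun c => qpt (f c) (g c) 0 i).
  move=> rf rg; apply: (@reg_ext K (cfg K) (@regc K)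
    (fun c => nth 0 [:: 1; f c; g c; f c * g c] i)) => [c'|]; first by rewrite mxE.
  move: i; apply: ord4_case => //=; [exact: (reg_cst (regc_alg K))|exact: rM].
move=> [[j B]|[j B]] i; first by apply: rq; [apply: (reg_cst (regc_alg K))|apply: rC].
pose u c := qpt (c 1%N j.*2) (c 2%N j.*2).
pose v (c : cfg K) := qpt (c 1%N j.*2.+1) (c 2%N j.*2.+1).
apply: (@reg_ext K (cfg K) (@regc K) (fun c => u c 0 i + B * (v c 0 i - u c 0 i))) => [c'|].
  by rewrite /secant !mxE.
apply: (reg_add (regc_alg K)); first exact: rq.
apply: rM; first exact: (reg_cst (regc_alg K)).
by apply: (reg_sub (regc_alg K)); apply: rq.
Qed.

(** Degenerate configurations are allowed: at c = 0 every line passes through the vertex e_0 or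
    shrinks to it. *)
Lemma E3_lt D Ms Ns : (exists j, D < mult Ms j) \/ (exists i, D < mult Ns i) -> E3 D Ms Ns.
Proof.
have e0 : qpt 0 0 = delta_mx 0 0.
  by apply/rowP; apply: ord4_case; rewrite !mxE //= mulr0.
move=> DM; exists (fun _ _ => 0) => F FD FP.
case: DM => [[j Dj]|[i Di]].
  apply: (ordge_vertex_gt (c := 0)) Dj FD _.
  by have := FP (inl (j, 0)); rewrite /= /ruling e0.
apply: (ordge_vertex_gt (c := 0)) Di FD _.
by have := FP (inr (i, 0)); rewrite /= /secant scale0r addr0 e0.
Qed.

(* The secant joining (0, b) and (1, b) is the ruling line y = b. *)
Lemma E3_specialize D Ms N Ns : E3 D (rcons Ms N) Ns -> E3 D Ms (N :: Ns).
Proof.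
move=> [c E]; pose r := size Ms.
pose c' : cfg K := fun k i => if k == 0%N then c 0%N i else
  match i with 0%N => if k == 1%N then 0 else c 0%N r
             | 1%N => if k == 1%N then 1 else c 0%N r | i.+2 => c k i end.
exists c' => F FD FP; apply: E => // -[[j B]|[i B]]; last first.
  exact: (FP (inr (i.+1, B))).
rewrite /= /mult nth_rcons; have [jr|jr|->] := ltngtP.
- exact: (FP (inl (j, B))).
- exact: ordge_npos.
have := FP (inr (0%N, B)); rewrite /= /mult /= /secant /c' /=.
congr (ordge _ _ _); apply/rowP; apply: ord4_case; rewrite !mxE /= /r; ring.
Qed.

Definition mnm3 (x y z : nat) : multinom 3 := Multinom [tuple of [:: x; y; z]].

Lemma mnm3E x y z i : mnm3 x y z i = nth 0%N [:: x; y; z] i.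
Proof. by rewrite multinomE (tnth_nth 0%N). Qed.

Definition qmon (i : 'I_4) : multinom 3 :=
  mnm3 (nth 0%N [:: 0; 1; 0; 1]%N i) (nth 0%N [:: 0; 0; 1; 1]%N i) (nth 0%N [:: 2; 1; 1; 0]%N i).

(* The parametrization (X_2^2 : X_0 X_2 : X_1 X_2 : X_0 X_1) of the quadric. *)
Definition qmap (i : 'I_4) : mpoly 3 K := mpolyX K (qmon i).

Definition qexp (m : multinom 4) : multinom 3 :=
  mnm3 (m 1%R + m 3%:R%R) (m 2%:R%R + m 3%:R%R) (2 * m 0%R + m 1%R + m 2%:R%R).

Lemma sum_ord4 (f : 'I_4 -> nat) :
  (\sum_(i < 4) f i = f 0%R + f 1%R + f 2%:R%R + f 3%:R%R)%N.
Proof.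
rewrite !big_ord_recl big_ord0 addn0 !addnA.
by congr (f _ + f _ + f _ + f _)%N; apply: val_inj.
Qed.

Lemma mdeg4 (m : multinom 4) : mdeg m = (m 0%R + m 1%R + m 2%:R%R + m 3%:R%R)%N.
Proof. by rewrite mdegE sum_ord4. Qed.

Lemma msub_qmap F : msub qmap F = \sum_(m <- msupp F) F@_m *: mpolyX K (qexp m).
Proof.
rewrite msubE; apply: eq_bigr => m _; congr (_ *: _).
rewrite mprodXnE; congr mpolyX; apply/mnmP => i.
rewrite mnm_sumE sum_ord4 !mulmnE /qmon !mnm3E; move: i; apply: ord3_case => /=; lia.
Qed.

Lemma meval_qmap (x y z : K) :
  \row_i meval (row3 x y z 0) (qmap i) = row4 (z * z) (x * z) (y * z) (x * y).
Proof.
apply/rowP; apply: ord4_case; rewrite !mxE /qmap mevalX !big_ord_recl big_ord0 !mxE /qmon !mnm3E /=;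
  rewrite ?expr0 ?expr1 ?mul1r ?mulr1 ?expr2 //.
Qed.

(** The factor 1 gives it the shape of a divisor in [binomial_division]. *)
Definition quadric : mpoly 4 K :=
  mpolyX K (mnm_add (mnm1 0) (mnm1 3%:R)) - 1 *: mpolyX K (mnm_add (mnm1 1) (mnm1 2%:R)).

Lemma psub_quadric z :
  psub quadric z = z 0 0 * z 0 3%:R - z 0 1 * z 0 2%:R.
Proof.
by rewrite psubB psubZ mul1r !mpolyXD !psubM !psubXU.
Qed.

Lemma meval_quadric x : meval x quadric = x 0 * x 3%:R - x 1 * x 2%:R.
Proof. by rewrite mevalB mevalZ mul1r !mpolyXD !mevalM !mevalXU. Qed.

Lemma quadric_factor D F : isform D F -> msub qmap F = 0 ->
  exists2 F', F = quadric * F' & isform (D - 2) F'.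
Proof.
move=> FD F0.
have [|||F' [R [FE F'D RD Rlam]]] := @binomial_division K 4
  (mnm_add (mnm1 0) (mnm1 3%:R)) (mnm_add (mnm1 1) (mnm1 2%:R)) 1 0 _ _ _ D F FD.
- by rewrite mnmDE !mnm1E.
- by rewrite mnmDE !mnm1E.
- by rewrite !mdegD !mdeg1.
rewrite mdegD !mdeg1 in F'D; exists F' => //; rewrite {1}FE.
suff -> : R = 0 by rewrite addr0.
have q0 : msub qmap quadric = 0.
  rewrite msubB msubZ scale1r !msubX; apply/eqP; rewrite subr_eq0; apply/eqP.
  rewrite !mprodXnE; congr mpolyX; apply/mnmP => i.
  rewrite !mnm_sumE !sum_ord4 !mulmnE !mnmDE !mnm1E /qmon !mnm3E.
  by move: i; apply: ord3_case.
have R0 : msub qmap R = 0.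
  by rewrite -F0 FE -/quadric msubD msubM q0 mul0r add0r.
(* The monomials of [R] lack X_0 or X_3, and on such monomials of a fixed degree [qexp] is
   injective. *)
rewrite msub_qmap in R0; apply: (relabel_eq0 (h := qexp)) R0 => m m' mR m'R /mnmP E.
have [E0 E1 E2] : [/\ (m 1%R + m 3%:R%R = m' 1%R + m' 3%:R%R)%N,
    (m 2%:R%R + m 3%:R%R = m' 2%:R%R + m' 3%:R%R)%N &
    (2 * m 0%R + m 1%R + m 2%:R%R = 2 * m' 0%R + m' 1%R + m' 2%:R%R)%N].
  by split; [have := E 0|have := E 1|have := E 2%:R]; rewrite !mnm3E.
have nR k : k \in msupp R -> k 0 = 0%N \/ k 3%:R = 0%N.
  move=> /Rlam kR; case: (posnP (k 0)) => [|k0]; first by left.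
  case: (posnP (k 3%:R)) => [|k3]; first by right.
  case/negP: kR; apply/mnm_lepP; apply: ord4_case; rewrite mnmDE !mnm1E //=; lia.
have dR k : k \in msupp R -> (k 0%R + k 1%R + k 2%:R%R + k 3%:R%R)%N = D :> int.
  by move=> /RD; rewrite degree_isE mdeg4 => /eqP.
have := nR _ mR; have := nR _ m'R; have := dR _ mR; have := dR _ m'R.
have mm : m 0 = m' 0 -> m 1 = m' 1 -> m 2%:R = m' 2%:R -> m 3%:R = m' 3%:R -> m = m'.
  by move=> ? ? ? ?; apply/mnmP; apply: ord4_case.
move: mm E0 E1 E2.
move: (m 0) (m 1) (m 2%:R) (m 3%:R) (m' 0) (m' 1) (m' 2%:R) (m' 3%:R) =>
  x0 x1 x2 x3 y0 y1 y2 y3 mm E0 E1 E2 d1 d2 n1 n2.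
by apply: mm; clear -E0 E1 E2 d1 d2 n1 n2; lia.
Qed.

Lemma ordge_restrict D F (x y z : K) M : isform D F -> z != 0 ->
  ordge F (qpt (x / z) (y / z)) M -> ordge (msub qmap F) (row3 x y z) M.
Proof.
move=> FD z0 FM; apply: ordge_msub; rewrite meval_qmap.
have -> : row4 (z * z) (x * z) (y * z) (x * y) = (z * z) *: qpt (x / z) (y / z).
  by apply/rowP; apply: ord4_case; rewrite !mxE /=; field.
by apply: (ordge_scale FD) FM; rewrite mulf_neq0.
Qed.

(** A form of degree D restricts to bidegree (D, D): in the chart, a curve of degree 2D whose
    exponents of X_0 and X_1 are at most D. *)
Lemma quadric_vertices D F : isform D F ->
  ordge (msub qmap F) (vtx K 0) D /\ ordge (msub qmap F) (vtx K 1) D.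
Proof.
move=> FD.
have GD : isform (D + D) (msub qmap F).
  rewrite (_ : D + D = D * 2%:Z); last lia.
  apply: isform_msub => // i; apply: supp_inX; rewrite degree_isE mdeg3 /qmon !mnm3E.
  by move: i; apply: ord4_case.
split; apply/(ordge_vertex _ _ GD) => m'; rewrite msub_qmap => /mcoeff_relabel[m mF ->].
  rewrite (_ : inord 0 = 0); last by apply: val_inj; rewrite /= inordK.
  by rewrite mnm3E /=; have := FD m mF; rewrite degree_isE mdeg4 => /eqP; lia.
rewrite (_ : inord 1 = 1); last by apply: val_inj; rewrite /= inordK.
by rewrite mnm3E /=; have := FD m mF; rewrite degree_isE mdeg4 => /eqP; lia.
Qed.

Lemma jet_quadric (b B : K) : (psub quadric (jet (ruling b B) (delta_mx 0 3%:R)))`_1 != 0.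
Proof.
rewrite psub_quadric !mxE /= !mulr0 !addr0 mulr1.
rewrite mul1r coefB coefD -polyCM !coefC coefX /= add0r subr0; exact: oner_neq0.
Qed.

Lemma quadric_secant c i s : meval (secant c i s 0) quadric = s * (1 - s) *
  ((c 1%N i.*2 - c 1%N i.*2.+1) * (c 2%N i.*2 - c 2%N i.*2.+1)).
Proof. by rewrite meval_quadric !mxE /=; ring. Qed.

(** Each secant meets the quadric in two points, whence 2p points of multiplicity N in the plane.
    After division by the quadric the rulings lose one unit, since the quadric vanishes simply on
    them; the secants lose none, since they are not contained in it. *)
Theorem E3_step D Ms N p (S := \sum_(M <- Ms) M) :
  E2 K (D + D - S) [:: D, D - S & nseq (2 * p) N] ->
  E3 (D - 2) (map (fun M => M - 1) Ms) (nseq p N) -> E3 D Ms (nseq p N).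
Proof.
move=> ED2 /E3_gen gE3; set r := size Ms.
(* The swap puts D - S at e_0, the vertex through which the ruling lines X_1 = b X_2 pass. *)
have {ED2} /E2_affine gE2 : E2 K (D + D - S) [:: D - S, D & nseq (2 * p) N].
  by apply: E2_perm ED2; rewrite (perm_catCA [:: D] [:: D - S]).
have rC := regc_coord (K := K); have rB := reg_sub (regc_alg K).
have gb : gen (fun c : cfg K => forall j, (j < r)%N -> forall j', (j' < r)%N ->
    j != j' -> c 0%N j - c 0%N j' != 0).
  apply: gen_forall => j _; apply: gen_forall => j' _.
  have [->|jj] := eqVneq j j'; first by apply: gen_true.
  apply: (@gen_mono _ (fun c : cfg K => c 0%N j - c 0%N j' != 0)) => //.
  apply: (@gen_neq0 _ _ (fun _ i => (i == j)%:R)); first exact: rB.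
  by rewrite eqxx [j' == j]eq_sym (negPf jj) subr0 oner_neq0.
have gy : gen (fun c : cfg K => forall k, (k < 2 * p)%N -> forall j, (j < r)%N ->
    c 2%N k - c 0%N j != 0).
  apply: gen_forall => k _; apply: gen_forall => j _.
  apply: (@gen_neq0 _ _ (fun l _ => (l == 2)%:R)); first exact: rB.
  by rewrite subr0 oner_neq0.
have gs : gen (fun c : cfg K => forall i, (i < p)%N ->
    (c 1%N i.*2 - c 1%N i.*2.+1) * (c 2%N i.*2 - c 2%N i.*2.+1) != 0).
  apply: gen_forall => i _; apply: (@gen_neq0 _ _ (fun _ l => (l == i.*2)%:R)).
    by apply: (reg_mul (regc_alg K)); apply: rB.
  by rewrite eqxx (gtn_eqF (ltnSn _)) subr0 mul1r oner_neq0.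
have [c [[[[cE3 cE2] cb] cy] cs]] :=
  gen_ex (gen_and (gen_and (gen_and (gen_and gE3 gE2) gb) gy) gs).
exists c => F FD FP.
pose bs := [seq (c 0%N j, mult Ms j) | j <- iota 0 r].
have bs1 : map fst bs = [seq c 0%N j | j <- iota 0 r] by rewrite -map_comp.
have bs2 : \sum_(bM <- bs) bM.2 = S.
  rewrite /S -(mkseq_nth 0 Ms) -/r /mkseq !big_map.
  by apply: eq_bigr.
have [G0 G1] := quadric_vertices FD.
have G00 : msub qmap F = 0.
  apply: (@lines_division K c bs (nseq (2 * p) N) _ _ (D + D) D D) => //.
  - rewrite bs1 map_inj_in_uniq ?iota_uniq // => j j'; rewrite !mem_iota !add0n /= => jr jr' /eqP.
    rewrite -subr_eq0; apply: contraTeq => jj; exact: cb.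
  - move=> k b; rewrite size_nseq bs1 => kp /mapP[j]; rewrite mem_iota => jr ->.
    by rewrite -subr_eq0 cy.
  - rewrite (_ : D + D = D * 2%:Z); last lia.
    apply: isform_msub => // i; apply: supp_inX; rewrite degree_isE mdeg3 /qmon !mnm3E.
    by move: i; apply: ord4_case.
  - move=> k; have [kp|kp] := ltnP k (2 * p); last first.
      by apply: ordge_npos; rewrite /mult nth_default // size_nseq.
    apply: (ordge_restrict FD (oner_neq0 _)); rewrite !divr1 /mult nth_nseq kp.
    have kE : k = (odd k + k./2.*2)%N by rewrite odd_double_half.
    have k2 : (k./2 < p)%N by rewrite -ltn_double -addnn -mul2n; lia.
    (* The k-th point is the end of secant k./2 with parameter 0 or 1, according to parity. *)
    have -> : qpt (c 1%N k) (c 2%N k) = secant c k./2 (odd k)%:R.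
      rewrite /secant {1 2}kE; case: (odd k) => /=.
        by rewrite scale1r addrC subrK.
      by rewrite scale0r addr0.
    by have := FP (inr (k./2, (odd k)%:R)); rewrite /= /mult nth_nseq k2.
  - move=> b M /mapP[j]; rewrite mem_iota => jr [-> ->] p0 p2 p20.
    apply: (ordge_restrict FD p20); rewrite mulfK //.
    exact: (FP (inl (j, p0 / p2))).
  - by rewrite bs2.
have [F' FE F'D] := quadric_factor FD G00.
rewrite FE [F'](_ : _ = 0) ?mulr0 //; apply: cE3 => // -[[j B]|[i B]] /=.
  have [jr|jr] := ltnP j r; last first.
    by apply: ordge_npos; rewrite /mult nth_default // size_map.
  have := FP (inl (j, B)); rewrite /= FE /mult (nth_map 0) // => FjB.
  exact: ordge_div FjB (jet_quadric _ _).
have [ip|ip] := ltnP i p; last by apply: ordge_npos; rewrite /mult nth_default // size_nseq.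
(* A secant meets the quadric only at s = 0 and s = 1; the order is found elsewhere and extended to
   these two points by density. *)
have [s' s'0] : exists s : K, s * (1 - s) != 0.
  have /poly_nonroot[s] : 'X * (1 - 'X) != 0 :> {poly K}.
    rewrite mulf_neq0 ?polyX_eq0 // -opprB oppr_eq0 -polyC1 polyXsubC_eq0 //.
  by rewrite !hornerE; exists s.
apply: (@ordge_line K 4 F' _ _ _ (fun s => s * (1 - s)) s').
- exists ('X * (1 - 'X)) => s; by rewrite !hornerE.
- by [].
move=> s s0; have := FP (inr (i, s)); rewrite /= FE => /ordge_div0; apply.
by rewrite quadric_secant mulf_neq0 // cs.
Qed.

Lemma E3_steps k D Ms N p :
  let S := \sum_(M <- Ms) M in let r := (size Ms)%:Z in
  (forall i, (i < k)%N -> E2 K (D + D - S + (r - 4) * i%:Z)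
     [:: D - i%:Z * 2, D - S + (r - 2) * i%:Z & nseq (2 * p) N]) ->
  E3 (D - k%:Z * 2) (map (fun M => M - k%:Z) Ms) (nseq p N) -> E3 D Ms (nseq p N).
Proof.
move=> S r; elim: k => [|k IH] H.
  rewrite mul0r subr0 (_ : map _ _ = Ms) // -[RHS]map_id.
  by apply: eq_map => M; rewrite subr0.
move=> E; apply: IH => [i ik|]; first by apply: H; rewrite ltnW.
apply: E3_step; last first.
  rewrite -map_comp /= (_ : D - k%:Z * 2 - 2 = D - k.+1%:Z * 2); last lia.
  by congr (E3 _ _ _): E; apply: eq_map => M /=; lia.
have -> : \sum_(M <- [seq M - k%:Z | M <- Ms]) M = S - r * k%:Z.
  rewrite big_map big_split /= sumrN big_const_seq count_predT iter_addr_0 -/S.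
  by rewrite -mulr_natr natz mulrC.
have := H k (ltnSn k); congr (E2 K _ _); first lia.
by congr [:: _, _ & _]; lia.
Qed.

End Space.

(** * Algorithm L *)

Section AlgorithmL.
Variables (K : closedFieldType) (tau : rat).
Hypothesis tau_gt0 : 0 < tau.

Lemma intr_mult (Ms : seq int) (qs : seq rat) (N : rat) j :
  map intr Ms = map ( *%R N) qs -> (j < size qs)%N -> (mult Ms j)%:~R = N * nth 0 qs j.
Proof.
move=> ME jq; have sz : size Ms = size qs by have /(congr1 size) := ME; rewrite !size_map.
have := congr1 (fun s => nth 0 s j) ME.
by rewrite (nth_map 0) ?sz // (nth_map 0).
Qed.

(** N0 collects the denominators of the values t0 of the run, so that each Step 2 splits off an
    integral number N t0 of quadrics. *)
Theorem algL_E3 delta qs p ans : algL tau delta qs p ans -> ans ->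
  exists2 N0, (0 < N0)%N & forall N, (0 < N)%N -> (N0 %| N)%N ->
    forall D Ms, D%:~R = N%:R * delta -> map intr Ms = map ( *%R N%:R) qs ->
    E3 K D Ms (nseq p N%:Z).
Proof.
elim=> {delta qs p ans} [delta qs p stop|delta qs p t0 ans _ _ T t0tau _ IH|delta qs p ans _ _ _ IH|//] ansT.
- exists 1%N => // N N0 _ D Ms DE ME; apply: E3_lt.
  have N0' : (0 : rat) < N%:R by rewrite ltr0n.
  case/orP: stop => [/andP[d1 p1]|/hasP[q qqs dq]]; [right|left].
    exists 0%N; case: p p1 => // p _; rewrite /mult /=.
    by rewrite -(ltr_int rat) DE -pmulrn gtr_pMr.
  exists (index q qs); rewrite -(ltr_int rat) DE (intr_mult ME) ?index_mem //.
  by rewrite nth_index // ltr_pM2l.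
- have [N0 N0_gt0 {}IH] := IH ansT; have t0_gt0 := lt_le_trans tau_gt0 t0tau.
  exists (N0 * absz (denq t0))%N => [|N N_gt0 /dvdnP[m mE] D Ms DE ME].
    by rewrite muln_gt0 N0_gt0 absz_gt0 denq_neq0.
  (* This is N t0; the numerator is nonnegative because t0 >= tau > 0. *)
  pose k := (m * N0 * absz (numq t0))%N.
  have kE : k%:R = N%:R * t0 :> rat.
    rewrite mE /k mulnA natrM [in RHS]natrM -mulrA; congr (_ * _).
    rewrite natr_absz ger0_norm ?numq_ge0 ?ltW // natr_absz ger0_norm ?denq_ge0 //.
    by rewrite numqE mulrC.
  apply: (@E3_steps K k) => [i ik|].
    apply: (algT_E2 _ T) => //.
    by rewrite -kE ltr_nat.
  apply: IH => //.
  + by rewrite mE mulnCA dvdn_mulr.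
  + by rewrite intrD mulrNz intrM DE mulrBr mulrCA -kE -!pmulrn [2 * _]mulrC.
  transitivity (map (fun x => x - k%:R : rat) (map intr Ms)).
    by rewrite -!map_comp; apply: eq_map => M /=; rewrite intrD mulrNz -pmulrn.
  rewrite ME -!map_comp; apply: eq_map => q /=.
  by rewrite kE mulrBr.
have [N0 N0_gt0 {}IH] := IH ansT; exists N0 => // N N_gt0 N0N D Ms DE ME.
apply/E3_specialize/IH => //.
by rewrite !map_rcons ME mulr1.
Qed.

End AlgorithmL.

(** * Symbolic powers *)

Section IdealPowers.
Variables (A : comNzRingType).
Implicit Types I J : set A.

Lemma ideal_mul_add I J a b : ideal_mul I J a -> ideal_mul I J b -> ideal_mul I J (a + b).
Proof.
move=> [s sI ->] [t tI ->]; exists (s ++ t); last by rewrite big_cat.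
by move=> ab; rewrite mem_cat => /orP[/sI|/tI].
Qed.

Lemma ideal_mul_prod I J a b : I a -> J b -> ideal_mul I J (a * b).
Proof.
move=> Ia Jb; exists [:: (a, b)]; last by rewrite big_seq1.
by move=> ab; rewrite inE => /eqP ->.
Qed.

Lemma ideal_exp0r I m : ideal_exp I m 0.
Proof. by case: m => [//|m]; exists [::]; rewrite ?big_nil. Qed.

Lemma ideal_expD I m a b : ideal_exp I m a -> ideal_exp I m b -> ideal_exp I m (a + b).
Proof. by case: m => [//|m]; apply: ideal_mul_add. Qed.

Lemma ideal_exp_sum I m (T : eqType) (r : seq T) (F : T -> A) :
  (forall t, t \in r -> ideal_exp I m (F t)) -> ideal_exp I m (\sum_(t <- r) F t).
Proof.
elim: r => [|t r IH] H; first by rewrite big_nil; apply: ideal_exp0r.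
rewrite big_cons; apply: ideal_expD; first by apply: H; rewrite mem_head.
by apply: IH => u ur; apply: H; rewrite in_cons ur orbT.
Qed.

Lemma ideal_expMl I m r a : ideal_exp I m a -> ideal_exp I m (r * a).
Proof.
elim: m r a => [//|m IH] r a [s sI ->]; rewrite mulr_sumr.
apply: ideal_exp_sum => -[b c] /sI /= [Ib Jc]; rewrite mulrCA.
by apply: ideal_mul_prod => //; apply: IH.
Qed.

Lemma ideal_expS I m a : ideal_exp I m.+1 a -> ideal_exp I m a.
Proof.
move=> [s sI ->]; apply: ideal_exp_sum => -[b c] /sI /= [_ Jc].
exact: ideal_expMl.
Qed.

Lemma ideal_exp_le I m n a : (m <= n)%N -> ideal_exp I n a -> ideal_exp I m a.
Proof.
by move/subnK <-; elim: (n - m)%N => // k IH /ideal_expS.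
Qed.

Lemma ideal_exp_pow I a k m b : I a -> ideal_exp I m b -> ideal_exp I (k + m) (a ^+ k * b).
Proof.
move=> Ia Jb; elim: k => [|k IH]; first by rewrite mul1r.
by rewrite exprS -mulrA; apply: ideal_mul_prod.
Qed.

(** For [J] prime and [h] outside it, this makes the powers of [I] and [J] agree after localization
    at [J]. *)
Lemma ideal_exp_conductor I J h m a : (forall b, J b -> I (h * b)) ->
  ideal_exp J m a -> ideal_exp I m (h ^+ m * a).
Proof.
move=> hJ; elim: m a => [//|m IH] a [s sJ ->]; rewrite mulr_sumr.
apply: ideal_exp_sum => -[b c] /sJ /= [Jb Jc].
rewrite exprS mulrACA; apply: ideal_mul_prod; [exact: hJ|exact: IH].
Qed.

End IdealPowers.

Section Subspaces.
Variables (K : closedFieldType) (n : nat).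
Implicit Types (V : {vspace 'rV[K]_n}) (f g : mpoly n K).

Definition vanish V : set (mpoly n K) := [set f | forall x, x \in V -> meval (x 0) f = 0].

Lemma reg1_meval_line (x v : 'rV[K]_n) f : reg1 (fun s => meval ((x + s *: v) 0) f).
Proof.
apply: (@reg_ext _ _ _ (fun s => (psub f (jet (x + s *: v) 0))`_0)) => [s|].
  exact: psub_jet_coef0.
apply: (regp_jet (reg1_alg K)) => i.
by apply: reg_ext (reg1_line (x 0 i) (v 0 i)) => s; rewrite !mxE.
Qed.

(** A line joining a point of [V] where [f] is nonzero to one where [g] is nonzero stays in [V], and
    at a general point of it neither vanishes. *)
Lemma vanishM V f g : vanish V (f * g) -> vanish V f \/ vanish V g.
Proof.
move=> fg; apply: contrapT => /not_orP[/existsNP[x /not_implyP[xV fx]]].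
move=> /existsNP[y /not_implyP[yV gy]].
have [t [ft gt]] : exists t, meval ((x + t *: (y - x)) 0) f != 0 /\
    meval ((x + t *: (y - x)) 0) g != 0.
  apply: (reg1_nonroot (s := 0) (s' := 1)); try exact: reg1_meval_line.
    by rewrite scale0r addr0; apply/eqP.
  by rewrite scale1r addrC subrK; apply/eqP.
have zV : x + t *: (y - x) \in V by rewrite memvD // memvZ // memvB.
by have /eqP := fg _ zV; rewrite mevalM mulf_eq0 (negPf ft) (negPf gt).
Qed.

Lemma vanish_prime V : prime_ideal (vanish V).
Proof.
split.
  split.
  - by apply/mem_set => x _; rewrite meval0.
  - apply/negP => /set_mem /(_ 0 (mem0v _)); rewrite meval1 => /eqP.
    by rewrite oner_eq0.
  - move=> a f g /set_mem fV /set_mem gV; apply/mem_set => x xV.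
    by rewrite mevalD mevalM fV // gV // mulr0 addr0.
move=> f g /set_mem /vanishM[H|H]; apply/orP; [left|right]; exact/mem_set.
Qed.

Definition linform (g : 'End('rV[K]_n)) (k : 'I_n) : mpoly n K :=
  \sum_j (g (delta_mx 0 j)) 0 k *: mpolyX K (mnm1 j).

Lemma meval_linform (g : 'End('rV[K]_n)) k (y : 'rV[K]_n) : meval (y 0) (linform g k) = g y 0 k.
Proof.
rewrite /linform raddf_sum /= [in RHS](row_sum_delta y) linear_sum /= summxE.
by apply: eq_bigr => j _; rewrite mevalZ mevalXU linearZ /= !mxE mulrC.
Qed.

Lemma isform_linform (g : 'End('rV[K]_n)) k : isform 1 (linform g k).
Proof. by apply: supp_in_sum => j _; apply/supp_inZ/isformXU. Qed.

Definition coprojv V : 'End('rV[K]_n) := (\1 - projv V)%VF.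

Lemma coprojvE V y : coprojv V y = y - projv V y.
Proof. by rewrite /coprojv add_lfunE opp_lfunE id_lfunE. Qed.

Lemma coprojv_eq0 V y : (coprojv V y == 0) = (y \in V).
Proof.
rewrite coprojvE; apply/eqP/idP => [/eqP|yV]; last by rewrite projv_id // subrr.
by rewrite subr_eq0 => /eqP ->; apply: memv_proj.
Qed.

Lemma vanish_coprojv V k : vanish V (linform (coprojv V) k).
Proof. by move=> y; rewrite meval_linform -coprojv_eq0 => /eqP ->; rewrite mxE. Qed.

Lemma separating_form V x : x \notin V -> exists l : mpoly n K,
  [/\ isform 1 l, vanish V l & meval (x 0) l != 0].
Proof.
move=> xV; have /rV0Pn[k gk] : coprojv V x != 0 by rewrite coprojv_eq0.
exists (linform (coprojv V) k); split; [exact: isform_linform|exact: vanish_coprojv|].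
by rewrite meval_linform.
Qed.

(* f(X) is recovered from h(Y, Z) = f(pY + (1 - p)Z), p the projection to V, by
   Y := X and Z := (1 - p)X; the order of f along V bounds the Z-degree of h. *)
Lemma ordge_ideal_exp V f m : (forall x, x \in V -> ordge f x m%:Z) ->
  ideal_exp (vanish V) m f.
Proof.
move=> fm; pose q := coprojv V.
pose h : mpoly (n + n) K := msub (fun k =>
  msub (fun i => mpolyX K (mnm1 (lshift n i))) (linform (projv V) k) +
  msub (fun i => mpolyX K (mnm1 (rshift n i))) (linform q k)) f.
pose S (i : 'I_(n + n)) := (n <= i)%N.
pose kap (i : 'I_(n + n)) : mpoly n K :=
  match fintype.split i with inl j => mpolyX K (mnm1 j) | inr j => linform q j end.
have kapl i : kap (lshift n i) = mpolyX K (mnm1 i).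
  by rewrite /kap; case: split_ordP => j /eqP; rewrite ?eq_shift // => /eqP ->.
have kapr i : kap (rshift n i) = linform q i.
  by rewrite /kap; case: split_ordP => j /eqP; rewrite ?eq_shift // => /eqP ->.
have hm m' : m' \in msupp h -> (m%:Z <= (wt S m')%:Z).
  move: m'; apply: (wt_ordge (q := 1)) => [|z _]; first exact: oner_neq0.
  apply: ordge_msub; set x := (X in ordge _ X _); apply: fm.
  pose y := \row_i z 0 (lshift n i).
  suff -> : x = projv V y by apply: memv_proj.
  apply/rowP => k; rewrite !mxE mevalD !meval_msub.
  rewrite [X in _ + X](_ : _ = meval ((0 : 'rV[K]_n) 0) (linform q k)); last first.
    by apply: meval_eq => i; rewrite mevalXU !mxE /S /= leq_addr.
  rewrite [X in X + _](_ : _ = meval (y 0) (linform (projv V) k)); last first.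
    by apply: meval_eq => i; rewrite mevalXU !mxE /S /= leqNgt ltn_ord.
  by rewrite !meval_linform linear0 mxE addr0.
have -> : f = msub kap h.
  apply/eqP; rewrite -subr_eq0; apply/eqP/mpoly_eq0 => x.
  rewrite mevalB meval_msub /h meval_msub; apply/eqP; rewrite subr_eq0; apply/eqP.
  apply: meval_eq => k; rewrite mevalD !meval_msub.
  rewrite [X in X + _](_ : _ = meval (x 0) (linform (projv V) k)); last first.
    by apply: meval_eq => i; rewrite mevalXU kapl mevalXU.
  rewrite [X in _ + X](_ : _ = meval (q x 0) (linform q k)); last first.
    by apply: meval_eq => i; rewrite mevalXU kapr meval_linform.
  rewrite !meval_linform /q !coprojvE linearB /= (projv_id (memv_proj V x)) subrr subr0.
  by rewrite !mxE; ring.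
rewrite msubE; apply: ideal_exp_sum => m' /hm mm.
rewrite -mul_mpolyC; apply: ideal_expMl.
rewrite big_split_ord /=; apply: ideal_expMl.
under eq_bigr => i _ do rewrite kapr.
apply: (ideal_exp_le (n := \sum_(i < n) m' (rshift n i))%N).
  move: mm; rewrite lez_nat /wt big_mkcond big_split_ord /= big1 ?add0n.
    by move/leq_trans; apply; apply: leq_sum => i _; case: ifP.
  by move=> i _; rewrite /S /= leqNgt ltn_ord.
elim: (index_enum _) => [|i r IH]; first by rewrite !big_nil.
by rewrite !big_cons; apply: ideal_exp_pow => //; apply: vanish_coprojv.
Qed.

End Subspaces.

Section SymbolicPowers.
Variables (K : closedFieldType) (s : nat).
Implicit Types (L : 'I_s -> line K) (f : mpoly 4 K).

Lemma ideal_exp_ordge L m f : ideal_exp (lines_ideal L) m f ->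
  forall i x, x \in val (L i) -> ordge f x m.
Proof.
elim: m f => [|m IH] f; first by move=> _ i x _; apply: ordge_npos.
move=> [t tI ->] i x xL; apply: ordge_sum => -[a b] /tI /= [aI bI].
have -> : m.+1%:Z = 1 + m%:Z by lia.
by apply: ordgeM; [apply/ordge1P/(aI i)|apply: (IH b bI i)].
Qed.

Lemma line_not_sub L i j : val (L j) != val (L i) ->
  exists h, vanish (val (L j)) h /\ ~ vanish (val (L i)) h.
Proof.
move=> ji; have [x xi xj] : exists2 x, x \in val (L i) & x \notin val (L j).
  have : ~~ (val (L i) <= val (L j))%VS.
    apply: contraNN ji => sub; rewrite eq_sym eqEdim sub.
    by rewrite (eqP (valP (L j))) (eqP (valP (L i))).
  by move/subvPn => [x ? ?]; exists x.
have [l [_ lj lx]] := separating_form xj; exists l; split=> // /(_ x xi).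
exact/eqP.
Qed.

(** A product of polynomials vanishing on the lines other than [L i]. Copies of [L i] itself
    contribute the factor 1, so repeated and intersecting lines are covered. *)
Lemma conductor L i : exists h, ~ vanish (val (L i)) h /\
  forall b, vanish (val (L i)) b -> lines_ideal L (h * b).
Proof.
have /choice[hf hfP] : forall j, exists h, ~ vanish (val (L i)) h /\
    (val (L j) != val (L i) -> vanish (val (L j)) h).
  move=> j; have [E|/line_not_sub[h [hj hi]]] := eqVneq (val (L j)) (val (L i)).
    exists 1; split=> // /(_ 0 (mem0v _)) /eqP; rewrite meval1.
    by rewrite oner_eq0.
  by exists h.
exists (\prod_j hf j); split.
  elim: (index_enum _) => [|j r IH].
    by rewrite big_nil => /(_ 0 (mem0v _)) /eqP; rewrite meval1 oner_eq0.
  by rewrite big_cons => /vanishM[/(hfP j).1|].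
move=> b bi j x xj; have [E|ji] := eqVneq (val (L j)) (val (L i)).
  by rewrite mevalM (bi x) ?mulr0 // -E.
by rewrite (bigD1 j) //= !mevalM ((hfP j).2 ji) ?mul0r.
Qed.

Lemma vanish_Ass L i : Ass (lines_ideal L) (vanish (val (L i))).
Proof.
split; first exact: vanish_prime.
have [h [hi hI]] := conductor L i; exists h; apply/seteqP; split => g /=.
  by move=> gi; rewrite mulrC; apply: hI.
by move=> /(_ i) /vanishM[].
Qed.

(** From left to right, the multiplier [g] is nonzero at general points of [L i], and the order
    extends from these to the whole line. Conversely, an associated prime (I : f0) lies in the ideal
    of some [L i] on which [f0] does not vanish; a power of the conductor of that line is the
    multiplier. *)
Lemma symbolic_powerE L m f : symbolic_power (lines_ideal L) m f <->
  forall i x, x \in val (L i) -> ordge f x m.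
Proof.
split=> [fs i x xi|fm P [[[P0 P1 _] _] [f0 PE]]].
  have [g gi /ideal_exp_ordge gf] := fs _ (vanish_Ass L i).
  have /existsNP[x0 /not_implyP[x0i gx0]] := gi.
  have /= := @ordge_line K 4 f x (x0 - x) m
    (fun s => meval ((x + s *: (x0 - x)) 0) g) 1 (reg1_meval_line _ _ _) _ _ 0.
  rewrite scale0r addr0; apply.
    by rewrite scale1r addrC subrK; apply/eqP.
  move=> t gt; apply: (ordge_div0 _ gt).
  by apply: (gf i); rewrite memvD // memvZ // memvB.
have [i f0i] : exists i, ~ vanish (val (L i)) f0.
  apply/existsNP => H; case/negP: P1; apply/mem_set; rewrite PE /= mul1r => i.
  exact: H.
have [h [hi hI]] := conductor L i.
exists (h ^+ m).
  rewrite PE /= => /(_ i) /vanishM[|//].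
  elim: m {fm} => [|m IH]; last by rewrite exprS => /vanishM[].
  by move=> /(_ 0 (mem0v _)) /eqP; rewrite meval1 oner_eq0.
apply: ideal_exp_conductor hI _; apply: ordge_ideal_exp => x xi.
exact: fm xi.
Qed.

End SymbolicPowers.

(** * Pluecker coordinates *)

Section Pluecker.
Variable K : closedFieldType.
Implicit Types (u v x w : 'rV[K]_4).

Lemma free_plucker u v : free [:: u; v] <-> exists a b, plucker u v a b != 0.
Proof.
rewrite free_cons span_seq1 /free span_seq1 dim_vline /=.
split=> [/andP[uv v0]|[a [b pab]]].
  have /rV0Pn[b vb] : v != 0 by case: (v =P 0) v0.
  apply: contrapT => /forallNP H; case/negP: uv; apply/vlineP.
  exists (u 0 b / v 0 b); apply/rowP => a; rewrite mxE.
  have := H a => /forallNP /(_ b) /negP; rewrite negbK /plucker subr_eq0 => /eqP E.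
  by rewrite mulrAC -E mulfK.
rewrite -[X in _ && X]negbK; apply/andP; split.
  apply: contraNN pab => /vlineP[k ->]; rewrite /plucker !mxE; apply/eqP; ring.
  have [v0|//] := eqVneq v 0.
by move: pab; rewrite v0 /plucker !mxE !mulr0 subrr eqxx.
Qed.

Lemma line_basis (L : line K) : exists u v, basis_of (val L) [:: u; v].
Proof.
have := vbasisP (val L); case: (vbasis (val L)) => t /=; rewrite (eqP (valP L)).
by case: t => [|u [|v [|]]] // _ bL; exists u, v.
Qed.

Lemma line_memP (L : line K) u v : basis_of (val L) [:: u; v] ->
  forall x, x \in val L <-> exists a b, x = a *: u + b *: v.
Proof.
move=> /span_basis <- x; rewrite span_cons span_seq1; split.
  by move=> /memv_addP[_ /vlineP[a ->] [_ /vlineP[b ->] ->]]; exists a, b.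
by move=> [a [b ->]]; apply: memv_add; rewrite memvZ // memv_line.
Qed.

Lemma line_of u v : free [:: u; v] -> exists L : line K, basis_of (val L) [:: u; v].
Proof.
move=> fuv; have d2 : \dim <<[:: u; v]>>%VS == 2%N by rewrite (eqP fuv).
by exists (@exist {vspace 'rV[K]_4} (fun V => \dim V == 2%N) _ d2); rewrite /basis_of /= eqxx.
Qed.

Variable s : nat.
Implicit Types (L : 'I_s -> line K) (f : mpoly 4 K).
Let N := #|plucker_index s|.

(* The rows of the skew matrix (p_ab) span the line with Pluecker coordinates p. *)
Definition plucker_row (p : 'I_N -> K) (k : 'I_s * 'rV[K]_4) : 'rV[K]_4 :=
  \row_b \sum_a k.2 0 a * p (enum_rank (k.1, a, b)).

Lemma plucker_rowE (u v : 'I_s -> 'rV[K]_4) i w :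
  plucker_row (plucker_point u v) (i, w) =
  (\sum_a w 0 a * u i 0 a) *: v i - (\sum_a w 0 a * v i 0 a) *: u i.
Proof.
apply/rowP => b; rewrite !mxE /= !mulr_suml -sumrB; apply: eq_bigr => a _.
by rewrite /plucker_point enum_rankK /plucker; ring.
Qed.

Lemma plucker_row_onto (u v : 'I_s -> 'rV[K]_4) i al be : free [:: u i; v i] ->
  exists w, plucker_row (plucker_point u v) (i, w) = al *: u i + be *: v i.
Proof.
move=> /free_plucker[a [b pab]].
have ab : a != b by apply: contraNneq pab => ->; rewrite /plucker subrr.
pose p := plucker (u i) (v i) a b.
(* Cramer's rule in the coordinates a and b, solving w.u = be and w.v = -al. *)
pose w : 'rV[K]_4 := ((be * v i 0 b + al * u i 0 b) / p) *: delta_mx 0 a +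
  ((- al * u i 0 a - be * v i 0 a) / p) *: delta_mx 0 b.
have wE (z : 'rV[K]_4) : \sum_k w 0 k * z 0 k =
    (be * v i 0 b + al * u i 0 b) / p * z 0 a + (- al * u i 0 a - be * v i 0 a) / p * z 0 b.
  rewrite (bigD1 a) //= (bigD1 b) 1?eq_sym //= big1 ?addr0 => [|k /andP[ka kb]].
    by rewrite !mxE !eqxx /= [b == a]eq_sym (negPf ab) !mulr1 !mulr0 addr0 add0r.
  by rewrite !mxE (negPf ka) (negPf kb) /= !mulr0 addr0 mul0r.
exists w; rewrite plucker_rowE !wE addrC -scaleNr.
by congr (_ *: _ + _ *: _); rewrite /p /plucker in pab *; field.
Qed.

Definition order_ge L (m : nat) f := forall i x, x \in val (L i) -> ordge f x m.

Lemma order_ge_plucker L (u v : 'I_s -> 'rV[K]_4) m f :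
  (forall i, basis_of (val (L i)) [:: u i; v i]) ->
  order_ge L m f <-> forall k, ordge f (plucker_row (plucker_point u v) k) m.
Proof.
move=> bL; split=> [fL [i w]|fp i x /(line_memP (bL i))[a [b ->]]].
  apply: (fL i); apply/(line_memP (bL i)); rewrite plucker_rowE addrC -scaleNr.
  by eexists; eexists.
by have [w <-] := plucker_row_onto a b (basis_free (bL i)).
Qed.

Definition has_small m k L := exists f, [/\ f != 0, (msize f <= k)%N & order_ge L m f].

Lemma supp_in_msize n k (F : mpoly n K) :
  supp_in [pred m | (mdeg m < k)%N] F <-> (msize F <= k)%N.
Proof.
split=> [Fk|Fk m mF]; last exact: leq_trans (msize_mdeg_lt mF) Fk.
by rewrite msizeE; apply/bigmax_leqP_seq => m mF _; apply: Fk.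
Qed.

Definition regm n (f : ('I_n -> K) -> K) := exists F : mpoly n K, forall p, f p = meval p F.

Lemma regm_alg n : regalg (@regm n).
Proof.
split=> [c|f g [F fF] [G gG]|f g [F fF] [G gG]].
- by exists (mpolyC n c) => p; rewrite mevalC.
- by exists (F + G) => p; rewrite mevalD fF gG.
- by exists (F * G) => p; rewrite mevalM fF gG.
Qed.

(** As equations serve all polynomials that vanish on the configurations with a small element.
    [plucker_row] is defined on the whole affine space of coordinates, so [empty_open] yields for
    any other configuration such a polynomial that is nonzero at it. *)
Lemma zariski_closed_has_small m k : zariski_closed [set L | has_small m k L].
Proof.
exists [set F | forall L (u v : 'I_s -> 'rV[K]_4),
  (forall i, basis_of (val (L i)) [:: u i; v i]) -> has_small m k L ->
  meval (plucker_point u v) F = 0] => L u v bL; split=> [Lbad F FS|LS].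
  exact: FS bL Lbad.
apply: contrapT => Lgood.
have emptyP L' (u' v' : 'I_s -> 'rV[K]_4) : (forall i, basis_of (val (L' i)) [:: u' i; v' i]) ->
    empty [pred m | (mdeg m < k)%N] (plucker_row (plucker_point u' v')) (fun=> m%:Z) <->
    ~ has_small m k L'.
  move=> bL'; split=> [E [f [f0 /supp_in_msize fk /(order_ge_plucker _ _ bL') fL]]|NB f fk fL].
    by move/eqP: f0; apply; apply: E.
  apply: contrapT => /eqP f0; apply: NB; exists f; split=> //; first exact/supp_in_msize.
  exact/(order_ge_plucker _ _ bL').
have [||phi [[F FE] phi0 phiP]] := @empty_open K 4 k _ _ _ _ _ (@regm N) plucker_row
    _ (regm_alg N) _ ((emptyP _ _ _ bL).2 Lgood).
- by move=> m'.
- move=> [i w] b; apply: (@reg_ext K ('I_N -> K) (@regm N)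
    (fun p => \sum_a w 0 a * p (enum_rank (i, a, b)))) => [p|]; first by rewrite mxE.
  apply: (reg_sum (regm_alg N)) => a; apply: (reg_mul (regm_alg N)).
    exact: (reg_cst (regm_alg N)).
  by exists (mpolyX K (mnm1 (enum_rank (i, a, b)))) => p; rewrite mevalXU.
case/eqP: phi0; rewrite FE; apply: LS => // L' u' v' bL' Lbad.
apply: contrapT => /eqP; rewrite -FE => /phiP /(emptyP _ _ _ bL').
exact.
Qed.

End Pluecker.

(** * Initial degrees *)

Section Alpha.
Variable K : closedFieldType.

Lemma alphaP n (I : set (mpoly n K)) : (exists2 f, I f & f != 0) ->
  (exists f, [/\ I f, f != 0 & msize f = (alpha I).+1]) /\
  forall f, I f -> f != 0 -> (alpha I < msize f)%N.
Proof.
move=> [f0 If0 f00].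
have ex : exists d, `[< exists2 f, I f & msize f = d.+1 >].
  by exists (msize f0).-1; apply/asboolP; exists f0; rewrite // -mpolySpred.
have [d /asboolP[f If fd] dmin] := ex_minnP ex.
have: [set d | (exists2 f, I f & msize f = d.+1) /\
   forall f, I f -> f != 0 -> (d.+1 <= msize f)%N] (alpha I).
  apply: (@getPex _ [set d | _]); exists d; split; first by exists f.
  move=> g Ig g0; rewrite (mpolySpred _ g0) ltnS; apply: dmin; apply/asboolP.
  by exists g; rewrite // -mpolySpred.
move=> [[g Ig gd] amin]; split=> //; exists g; split=> //.
by rewrite -msize_poly_eq0 gd.
Qed.

Lemma isform_msize n (D : nat) (F : mpoly n K) : isform D F -> (msize F <= D.+1)%N.
Proof.
move=> FD; rewrite msizeE; apply/bigmax_leqP_seq => m /FD.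
by rewrite degree_isE => /eqP[->].
Qed.

Lemma psub_scale n (F : mpoly n K) (d : nat) (t : K) z : isform d F ->
  psub F (t%:P *: z) = (t ^+ d)%:P * psub F z.
Proof.
move=> Fd; rewrite !psubE mulr_sumr; apply: eq_big_seq => m /Fd.
rewrite degree_isE => /eqP[<-]; rewrite mulrCA; congr (_ * _).
under eq_bigr => i _ do rewrite mxE exprMn.
by rewrite big_split /= prodrXr -mdegE rmorphXn.
Qed.

Lemma isform_pihomog n (f : mpoly n K) (d : nat) : isform d (pihomog mdeg d f).
Proof. by move=> m mf; have /dhomog_mf/(_ m mf) := pihomogP mdeg d f; rewrite degree_isE => ->. Qed.

(** Scaling point and arc by t turns each jet coefficient of [f] into a polynomial in t whose
    coefficients are those of the homogeneous components. It is needed because symbolic powers also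
    contain inhomogeneous polynomials. *)
Lemma ordge_pihomog n (f : mpoly n K) x M d :
  (forall l : K, ordge f (l *: x) M) -> ordge (pihomog mdeg d f) x M.
Proof.
move=> fx y j jM.
have [dlt|dge] := ltnP d (msize f); last first.
  rewrite (_ : pihomog _ _ _ = 0) ?psub0 ?coef0 // pihomogE big1_seq // => m.
  case/andP => /eqP md /msize_mdeg_lt; rewrite md ltnNge dge //.
pose c e := (psub (pihomog mdeg e f) (jet x y))`_j.
have : \sum_(e < msize f) c e *: 'X^e = 0 :> {poly K}.
  apply/eqP; apply: contraT => /poly_nonroot[t]; rewrite horner_sum.
  have := fx t (t%:P *: y) j jM.
  have -> : jet (t *: x) (t%:P *: y) = t%:P *: jet x y.
    by apply/rowP => i; rewrite !mxE polyCM mulrDr [in RHS]mulrCA.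
  rewrite [f in psub f](pihomog_partitionE (mf := mdeg) (leqnn (msize f))).
  rewrite /psub raddf_sum coef_sum /= => E; rewrite (_ : \sum_i _ = 0) ?eqxx //.
  rewrite -[RHS]E; apply: eq_bigr => e _; rewrite -/(psub _ _) (psub_scale _ _ (@isform_pihomog _ f e)).
  by rewrite coefCM hornerZ hornerXn mulrC.
move/(congr1 (fun p : {poly K} => p`_d)); rewrite coef0 coef_sum.
rewrite (bigD1 (Ordinal dlt)) //= coefZ coefXn eqxx mulr1 big1 ?addr0 //.
move=> e ed; rewrite coefZ coefXn; case: eqP => [E|]; rewrite ?mulr0 //.
by case/eqP: ed; apply: val_inj.
Qed.

Variable s : nat.
Implicit Types (L : 'I_s -> line K).

Definition symb L m := symbolic_power (lines_ideal L) m.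

(** The product of m-th powers of linear forms, one through each line; it makes [alpha] meaningful
    and bounded uniformly in [L]. *)
Lemma symb_small L m : exists f, [/\ f != 0, (msize f <= (s * m).+1)%N & order_ge L m f].
Proof.
have /choice[l lP] : forall i, exists l, [/\ isform 1 l, vanish (val (L i)) l & l != 0].
  move=> i; have : ~~ ({:'rV[K]_4} <= val (L i))%VS.
    apply/negP => /dimvS; rewrite (eqP (valP (L i))) dimvf /dim /=.
    by [].
  move=> /subvPn[x _ xL]; have [l [l1 lL lx]] := separating_form xL.
  by exists l; split=> //; apply: contraNneq lx => ->; rewrite meval0.
exists (\prod_i l i ^+ m); split.
- by apply/prodf_neq0 => i _; case: (lP i) => _ _ l0; rewrite expf_neq0.
- apply: isform_msize; rewrite (_ : Posz _ = \sum_(i < s) 1 * m%:Z).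
    by apply: isform_prod => i; apply: isformXn; case: (lP i).
  by rewrite sumr_const card_ord mul1r -mulr_natr natz; lia.
move=> i x xi; rewrite (bigD1 i) //= -[X in ordge _ _ X]addr0; apply: ordgeM; last exact: ordge_npos.
move=> y; rewrite /psub rmorphXn -[X in vge _ X]mulr1; apply: vgeX.
suff l1 : ordge (l i) x 1 by apply: l1.
by apply/ordge1P; case: (lP i) => _ lL _; apply: lL.
Qed.

Lemma symbP L m f : symb L m f <-> order_ge L m f.
Proof. exact: symbolic_powerE. Qed.

Lemma symb_neq0 L m : exists2 f, symb L m f & f != 0.
Proof. by have [f [f0 _ /symbP fL]] := symb_small L m; exists f. Qed.

Lemma alpha_leP L m k : has_small m k L <-> (alpha (symb L m) < k)%N.
Proof.
have [[g [/symbP gL g0 gd]] amin] := alphaP (symb_neq0 L m).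
split=> [[f [f0 fk /symbP fL]]|ak]; first exact: leq_trans (amin f fL f0) fk.
by exists g; rewrite gd.
Qed.

Lemma alpha_bound L m : (alpha (symb L m) <= s * m)%N.
Proof. by rewrite -ltnS; apply/alpha_leP; apply: symb_small. Qed.

Lemma alpha_subadditive L m n :
  (alpha (symb L (m + n)) <= alpha (symb L m) + alpha (symb L n))%N.
Proof.
have [[f [/symbP fL f0 fd]] _] := alphaP (symb_neq0 L m).
have [[g [/symbP gL g0 gd]] _] := alphaP (symb_neq0 L n).
rewrite -ltnS; apply/alpha_leP; exists (f * g); split; first by rewrite mulf_neq0.
  by rewrite msizeM // fd gd addSn addnS.
by move=> i x xi; rewrite PoszD; apply: ordgeM; [apply: (fL i)|apply: (gL i)].
Qed.

Lemma line_exists : exists L : line K, True.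
Proof.
have [|L _] := @line_of K (delta_mx 0 0) (delta_mx 0 1); last by exists L.
apply/free_plucker; exists 0, 1.
by rewrite /plucker !mxE /= mulr1 mul0r subr0 oner_neq0.
Qed.

Lemma generic_alpha m : exists d, (exists L, ~ has_small m d L) /\
  forall L, (alpha (symb L m) <= d)%N /\ (~ has_small m d L -> alpha (symb L m) = d).
Proof.
have ex : exists d, `[< exists L, alpha (symb L m) = d >].
  by have [l _] := line_exists; exists (alpha (symb (fun=> l) m)); apply/asboolP; exists (fun=> l).
have bd d : `[< exists L, alpha (symb L m) = d >] -> (d <= s * m)%N.
  by move=> /asboolP[L <-]; apply: alpha_bound.
have [d /asboolP[L Ld] dmax] := ex_maxnP ex bd; exists d.
have le L' : (alpha (symb L' m) <= d)%N by apply: dmax; apply/asboolP; exists L'.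
split; first by exists L => /alpha_leP; rewrite Ld ltnn.
move=> L'; split=> // /alpha_leP/negP; rewrite -leqNgt => dL.
by apply/eqP; rewrite eqn_leq le.
Qed.

End Alpha.

(** * Very general lines *)

Section VeryGeneral.
Variable K : closedFieldType.
Hypothesis uncountableK : ~ countable [set: K].

Lemma poly_avoid_countable (p : nat -> {poly K}) : (forall i, p i != 0) ->
  exists t, forall i, (p i).[t] != 0.
Proof.
move=> p0; apply: contrapT => H; apply: uncountableK.
have -> : [set: K] = \bigcup_i [set t | root (p i) t].
  apply/seteqP; split => // t _; apply: contrapT => Ht; apply: H; exists t => i.
  by apply/negP => pit; apply: Ht; exists i.
apply: bigcup_countable => // i _; apply: finite_set_countable.
have [r rE] := closed_field_poly_normal (p i).
apply: (@sub_finite_set _ _ [set` r]); last exact: finite_seq.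
move=> t /=; rewrite rE rootZ ?lead_coef_eq0 // root_prod_XsubC.
exact.
Qed.

Variable s : nat.
Implicit Types (L : 'I_s -> line K).
Let V : finType := ('I_s * bool * 'I_4)%type.
Let vec (x : 'rV[K]_#|V|) b i : 'rV[K]_4 := \row_a x 0 (enum_rank (i, b, a)).
Let pX (i : 'I_s) b a : mpoly #|V| K := mpolyX K (mnm1 (enum_rank (i, b, a))).
Let pp (k : 'I_#|plucker_index s|) : mpoly #|V| K :=
  let: (i, a, b) := enum_val k in pX i true a * pX i false b - pX i true b * pX i false a.

Let meval_pp (x : 'rV[K]_#|V|) (F : mpoly #|plucker_index s| K) :
  meval (x 0) (msub pp F) = meval (plucker_point (vec x true) (vec x false)) F.
Proof.
rewrite meval_msub; apply: meval_eq => k; rewrite /pp /plucker_point.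
case: (enum_val k) => -[i a] b; rewrite mevalB !mevalM !mevalXU /plucker.
by rewrite !mxE.
Qed.

Let vecK (u v : 'I_s -> 'rV[K]_4) : exists x, vec x true = u /\ vec x false = v.
Proof.
exists (\row_j let: (i, b, a) := enum_val j in (if b then u i else v i) 0 a).
by split; apply/funext => i; apply/rowP => a; rewrite !mxE enum_rankK.
Qed.

(** Lines are parametrized by pairs of spanning vectors, so each proper closed set pulls back into
    the zeros of a nonzero polynomial on an affine space. *)
Lemma zariski_avoid (Z : nat -> set ('I_s -> line K)) :
  (forall n, zariski_closed (Z n) /\ Z n <> setT) -> exists L, forall n, ~ Z n L.
Proof.
move=> HZ.
have ex n : exists F : mpoly #|plucker_index s| K,
    msub pp F != 0 /\ forall L (u v : 'I_s -> 'rV[K]_4),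
      (forall i, basis_of (val (L i)) [:: u i; v i]) -> Z n L ->
      meval (plucker_point u v) F = 0.
  have [[S SP] ZT] := HZ n.
  have [L ZL] : exists L, ~ Z n L.
    by apply/existsNP => H; apply: ZT; apply/seteqP; split.
  have /choice[u /choice[v bL]] : forall i, exists u v, basis_of (val (L i)) [:: u; v].
    by move=> i; apply: line_basis.
  have /existsNP[F /not_implyP[SF F0]] : ~ forall F, S F -> meval (plucker_point u v) F = 0.
    by move/(SP _ _ _ bL).
  exists F; split=> [|L' u' v' bL' /(SP _ _ _ bL')]; last exact.
  have [x [xu xv]] := vecK u v; apply/eqP => pF0; apply: F0.
  by rewrite -xu -xv -meval_pp pF0 meval0.
have /choice[F FP] := ex.
(* Where [H] is nonzero each pair of vectors spans a line; it enters the countable family at index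
   0. *)
pose H : mpoly #|V| K := \prod_i (pX i true 0 * pX i false 1 - pX i true 1 * pX i false 0).
have HE (x : 'rV[K]_#|V|) : meval (x 0) H = \prod_i plucker (vec x true i) (vec x false i) 0 1.
  rewrite rmorph_prod; apply: eq_bigr => i _.
  by rewrite /= mevalB !mevalM !mevalXU /plucker !mxE.
have H0 : H != 0.
  have [x [xu xv]] := vecK (fun=> delta_mx 0 0) (fun=> delta_mx 0 1).
  have : meval (x 0) H != 0.
    rewrite HE xu xv; apply/prodf_neq0 => i _.
    by rewrite /plucker !mxE /= mulr1 mul0r subr0 oner_neq0.
  by apply: contraNneq => ->; rewrite meval0.
have [[|n]|x xP] := mpoly_avoid poly_avoid_countable
    (F := fun n => if n is n'.+1 then msub pp (F n') else H); [exact: H0|exact: (FP n).1|].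
have /choice[L bL] : forall i, exists L : line K, basis_of (val L) [:: vec x true i; vec x false i].
  move=> i; apply: line_of; apply/free_plucker; exists 0, 1.
  by have := xP 0%N; rewrite HE => /prodf_neq0; apply.
exists L => n ZL; have := xP n.+1; rewrite meval_pp.
by rewrite ((FP n).2 L _ _ bL ZL) eqxx.
Qed.

Lemma very_general_meet (Q1 Q2 : ('I_s -> line K) -> Prop) :
  very_general Q1 -> very_general Q2 -> exists L, Q1 L /\ Q2 L.
Proof.
move=> [Z1 [H1 Q1P]] [Z2 [H2 Q2P]].
(* The two countable families are interleaved by parity. *)
have [n|L LP] := @zariski_avoid (fun n => if odd n then Z1 n./2 else Z2 n./2).
  by case: odd.
exists L; split; [apply: Q1P => -[n _]|apply: Q2P => -[n _]].
  by have := LP n.*2.+1; rewrite /= odd_double uphalf_double.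
by have := LP n.*2; rewrite odd_double doubleK.
Qed.

End VeryGeneral.

(** Passage from forms of degree exactly D to all polynomials of degree at most D: a nonzero
    homogeneous component, times a power of X_0, is a form of degree D subject to the same
    conditions. *)
Lemma E3_lines (K : closedFieldType) (s : nat) (D : int) (N : nat) : E3 K D [::] (nseq s N%:Z) ->
  exists L : 'I_s -> line K, forall f, f != 0 -> order_ge L N f -> D < (msize f).-1%:Z.
Proof.
move=> /E3_gen gE.
have gx : gen (fun c : cfg K => forall i, (i < s)%N -> c 1%N i.*2 - c 1%N i.*2.+1 != 0).
  apply: gen_forall => i _; apply: (@gen_neq0 _ _ (fun _ l => (l == i.*2)%:R)).
    by apply: (reg_sub (regc_alg K)); apply: regc_coord.
  by rewrite eqxx (gtn_eqF (ltnSn _)) subr0 oner_neq0.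
have [c [cE cx]] := gen_ex (gen_and gE gx).
pose u (i : nat) : 'rV[K]_4 := qpt (c 1%N i.*2) (c 2%N i.*2).
pose v (i : nat) : 'rV[K]_4 := qpt (c 1%N i.*2.+1) (c 2%N i.*2.+1).
have /choice[L bL] : forall i : 'I_s, exists L : line K, basis_of (val L) [:: u i; v i].
  move=> i; apply: line_of; apply/free_plucker; exists 1, 0.
  by rewrite /plucker !mxE /= mulr1 mul1r cx.
exists L => f f0 fL; rewrite ltNge; apply/negP => fD.
have [d fd] : exists d : 'I_(msize f), pihomog mdeg d f != 0.
  apply: contrapT => /forallNP H; case/eqP: f0.
  rewrite (pihomog_partitionE (mf := mdeg) (leqnn (msize f))) big1 // => d _.
  by apply: contrapT => /eqP; apply: H.
pose e := absz (D - d%:Z).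
have dD : d%:Z <= D by apply: le_trans fD; have := ltn_ord d; lia.
suff : pihomog mdeg d f * mpolyX K (mnm1 0) ^+ e = 0.
  move/eqP; rewrite mulf_eq0 (negPf fd) /= expf_eq0 => /andP[_].
  by rewrite -msupp_eq0 msuppX.
apply: cE => [|[[j B]|[i B]]].
- rewrite (_ : D = d%:Z + 1 * e%:Z); last by rewrite /e; lia.
  by apply: isformM; [apply: isform_pihomog|apply/isformXn/isformXU].
- by apply: ordge_npos; rewrite /= /mult nth_nil.
rewrite /= -[mult _ _]addr0; apply: ordgeM; last exact: ordge_npos.
rewrite /mult nth_nseq; case: ltnP => [ip|_]; last exact: ordge_npos.
apply: ordge_pihomog => l; apply: (fL (Ordinal ip)).
apply/(line_memP (bL (Ordinal ip))); exists (l * (1 - B)), (l * B).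
by apply/rowP => k; rewrite /secant /u /v !mxE /=; ring.
Qed.

(** * Fekete's lemma and the bound on the Waldschmidt constant *)

Section Fekete.
Variable R : realType.

Lemma subadditive_cvg (a : nat -> nat) :
  (forall m n, (a (m + n) <= a m + a n)%N) ->
  cvgn (fun m => (a m)%:R / m%:R : R).
Proof.
move=> sub; pose u m : R := (a m)%:R / m%:R.
pose E := [set u m | m in [set m | (0 < m)%N]].
have lbE : lbound E 0 by move=> _ [m _ <-]; rewrite divr_ge0 // ler0n.
have E0 : E !=set0 by exists (u 1%N), 1%N.
have hE : has_inf E by split=> //; exists 0.
have amul q k : (a (q * k) <= q * a k + a 0)%N.
  elim: q => [|q IH]; first by rewrite !mul0n.
  by rewrite !mulSn (leq_trans (sub _ _)) // -addnA leq_add2l.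
apply/cvg_ex; exists (inf E); apply/cvgrPdist_lt => eps eps0.
have [_ [k /= k0 <-] uk] := inf_adherent (divr_gt0 eps0 (ltr0n R 2)) hE.
(* One constant for all remainders modulo k; the summand a 0 is the error term in [amul], since a 0
   may be nonzero. *)
pose C := (a 0 + \sum_(r < k) a r)%N.
have aC n : (a n <= (n %/ k) * a k + C)%N.
  rewrite {1}(divn_eq n k) (leq_trans (sub _ _)) // /C addnA leq_add ?amul //.
  by rewrite (bigD1 (Ordinal (ltn_pmod n k0))) //= leq_addr.
have k0R : 0 < k%:R :> R by rewrite ltr0n.
near=> n.
have n0 : (0 < n)%N by near: n; exists 1%N.
have n0R : 0 < n%:R :> R by rewrite ltr0n.
have infn : inf E <= u n by apply: ge_inf; [exists 0|exists n].
rewrite distrC ger0_norm ?subr_ge0 //.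
have un : u n <= u k + C%:R / n%:R.
  rewrite /u ler_pdivrMr // mulrDl divfK ?gt_eqF //.
  apply: (@le_trans _ _ (((n %/ k) * a k + C)%N%:R)); first by rewrite ler_nat.
  have qk : (n %/ k)%:R <= n%:R / k%:R :> R.
    by rewrite ler_pdivlMr // -natrM ler_nat leq_divM.
  by rewrite natrD lerD2r natrM mulrC -mulrA ler_wpM2l // mulrC.
have Cn : C%:R / n%:R < eps / 2.
  rewrite ltr_pdivrMr // mulrC -ltr_pdivrMr ?divr_gt0 //.
  near: n; exact: nbhs_infty_gtr.
rewrite -/(u n); lra.
Unshelve. all: by end_near.
Qed.

End Fekete.

Theorem lemma19 (R : realType) (K : closedFieldType)
  (charK : [pchar K] =i pred0) (uncountableK : ~ countable [set: K])
  (tau : rat) (tau_gt0 : 0 < tau) (delta : rat) (s : nat) (s_ge1 : (1 <= s)%N)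
  (yes : algL tau delta [::] s true) :
  ratr delta <= alpha_hat K R s.
Proof.
have /choice[d dP] := @generic_alpha K s.
have vg : very_general (fun L : 'I_s -> line K => forall m, alpha (symb L m) = d m).
  exists (fun m => [set L | has_small m (d m) L]); split=> [m|L LZ m].
    split; first exact: zariski_closed_has_small.
    have [[L nb] _] := dP m => ZT; apply: nb.
    by have : [set: 'I_s -> line K] L by []; rewrite -ZT.
  by apply: ((dP m).2 L).2 => bL; apply: LZ; exists m.
(* [alpha_hat] is a chosen value, so its property needs a witness: the limit formed with the maxima
   d m, which are attained simultaneously on a very general set. *)
have : very_general (fun L : 'I_s -> line K => waldschmidt R (lines_ideal L) = alpha_hat K R s).
  apply: (@getPex _ [set c : R | very_general (fun L : 'I_s -> line K =>
    waldschmidt R (lines_ideal L) = c)]).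
  exists (lim ((fun m : nat => (d m)%:R / m%:R : R) @ \oo)).
  have [Z [HZ ZP]] := vg; exists Z; split=> // L /ZP LZ.
  rewrite /waldschmidt (_ : (fun m : nat => _) = (fun m => (d m)%:R / m%:R)) //.
  by apply/funext => m; rewrite -LZ.
move=> /(very_general_meet uncountableK vg)[L [Ld <-]].
rewrite /waldschmidt; have sub m n := alpha_subadditive L m n.
apply: limr_ge; first exact: subadditive_cvg sub.
have [N0 N0_gt0 H] := algL_E3 K tau_gt0 yes isT.
near=> n; have n0 : (0 < n)%N by near: n; exists 1%N.
(* Independent of n: every multiple N = q n is divisible by N0 and makes N delta an integer. *)
pose q := (N0 * absz (denq delta))%N.
have q0 : (0 < q)%N by rewrite muln_gt0 N0_gt0 absz_gt0 denq_neq0.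
have DE : ((N0 * n)%:Z * numq delta)%:~R = (q * n)%:R * delta :> rat.
  rewrite intrM numqE /q !natrM natr_absz ger0_norm ?denq_ge0 // -pmulrn natrM; ring.
have qn0 : (0 < q * n)%N by rewrite muln_gt0 q0.
have N0q : (N0 %| q * n)%N by rewrite /q -mulnA dvdn_mulr.
(* The bound at level q n holds for the special [L']. It passes to [L], where [alpha] is maximal,
   and then down to level n by subadditivity; so it holds for every n > 0. *)
have [L' L'f] := E3_lines (H _ qn0 N0q _ [::] DE erefl).
have [[f [/symbP fL f0 fE]] _] := alphaP (symb_neq0 L' (q * n)).
have := L'f f f0 fL; rewrite fE /= -(ltr_int rat) DE => lt1.
have amul k : (alpha (symb L (k * n)) <= k * alpha (symb L n))%N.
  elim: k => [|k IH]; last by rewrite !mulSn (leq_trans (sub _ _)) // leq_add2l.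
  by rewrite !mul0n (leq_trans (alpha_bound _ _)) // muln0.
have lt2 : (q * n)%:R * delta < q%:R * (alpha (symb L n))%:R :> rat.
  apply: lt_le_trans lt1 _; rewrite -pmulrn -natrM ler_nat (leq_trans _ (amul q)) //.
  by rewrite Ld; apply: ((dP _).2 L').1.
have lt3 : delta < (alpha (symb L n))%:R / n%:R.
  by move: lt2; rewrite natrM -mulrA ltr_pM2l ?ltr0n // ltr_pdivlMr ?ltr0n // mulrC.
have : ratr delta <= ratr ((alpha (symb L n))%:R / n%:R) :> R by rewrite ler_rat ltW.
by rewrite fmorph_div /= !rmorph_nat.
Unshelve. all: by end_near.
Qed.
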